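(* Let $G$ be a $2$-connected graph on $n$ vertices. Then $rc_2(G)\leq n$, with equality if and only if $G$ is a cycle of order $n$. Consequently, the minimum constant $\alpha>0$ such that $rc_2(G)\leq \alpha n$ holds for every $2$-connected graph $G$ (where $n$ denotes the number of vertices of $G$) is $\alpha=1$.
   Context: All graphs are simple, finite and undirected. An edge-coloring of a graph is an arbitrary assignment of colors to its edges (adjacent edges may receive the same color). A path in an edge-colored graph is called rainbow if no two of its edges have the same color. Two paths $P', P''$ between two distinct vertices $u$ and $v$ are internally disjoint if $V(P')\cap V(P'')=\{u,v\}$. For a $2$-connected graph $G$, an edge-coloring makes $G$ rainbow $2$-connected if every pair of distinct vertices of $G$ is connected by at least two internally disjoint rainbow paths. The rainbow $2$-connection number $rc_2(G)$ is the minimum number of colors in an edge-coloring of $G$ that makes $G$ rainbow $2$-connected. *)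

(* Defs.v *)
From HB Require Import structures.
From mathcomp Require Import all_boot all_order all_algebra.
From mathcomp Require Import reals.

Set Implicit Arguments.
Unset Strict Implicit.
Unset Printing Implicit Defensive.

Import Order.TTheory GRing.Theory Num.Theory.

Record sgraph := SGraph {
  vertex :> finType;
  adj : rel vertex;
  adj_sym : symmetric adj;
  adj_irrefl : irreflexive adj
}.

Definition connected_on (G : sgraph) (A : {set G}) : Prop :=
  A != set0 /\
  forall x y : G, x \in A -> y \in A ->
    connect [rel a b | [&& a \in A, b \in A & adj a b]] x y.

Definition k_connected (k : nat) (G : sgraph) : Prop :=
  k < #|G| /\ forall X : {set G}, #|X| < k -> connected_on (~: X).

Definition two_connected (G : sgraph) : Prop := k_connected 2 G.

(* The cycle of order n, presented on 'I_n with i adjacent to i + 1 mod n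
   ([ordS]); the bound rules out the degenerate cases n <= 2. *)
Definition is_cycle (G : sgraph) (n : nat) : Prop :=
  2 < n /\
  exists2 f : 'I_n -> G, bijective f &
    forall i j : 'I_n, adj (f i) (f j) = (j == ordS i) || (i == ordS j).

(* A path from u to v is given by u and the sequence p of its remaining
   vertices, v being the last one. *)
Definition is_path (G : sgraph) (u v : G) (p : seq G) : bool :=
  [&& path (@adj G) u p, last u p == v & uniq (u :: p)].

Definition path_edges (G : sgraph) (u : G) (p : seq G) : seq {set G} :=
  pairmap (fun x y => [set x; y]) u p.

(* An edge is encoded as the pair {x, y} of its ends; the colors are
   0, ..., k - 1, and the values of c outside the edges play no role. *)
Definition edge_coloring (G : sgraph) (k : nat) (c : {set G} -> nat) : Prop :=
  forall x y : G, adj x y -> c [set x; y] < k.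

Definition rainbow (G : sgraph) (c : {set G} -> nat) (u : G) (p : seq G)
    : bool :=
  uniq [seq c e | e <- path_edges u p].

Definition internally_disjoint (G : sgraph) (u v : G) (p q : seq G) : Prop :=
  [set w in u :: p] :&: [set w in u :: q] = [set u; v].

(* [p != q] is needed: the path consisting of a single edge uv satisfies
   [internally_disjoint] together with itself. *)
Definition rainbow_2connected (G : sgraph) (c : {set G} -> nat) : Prop :=
  forall u v : G, u != v ->
    exists p q : seq G,
      [/\ is_path u v p && is_path u v q,
          rainbow c u p && rainbow c u q,
          p != q & internally_disjoint u v p q].

Definition rainbow_2connectable (G : sgraph) (k : nat) : Prop :=
  exists2 c : {set G} -> nat, edge_coloring k c & rainbow_2connected c.

(* rc_2(G) = r.  A relation rather than a function, so that no value has to be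
   invented for graphs without any rainbow 2-connected coloring. *)
Definition is_rc2 (G : sgraph) (r : nat) : Prop :=
  rainbow_2connectable G r /\
  forall k : nat, rainbow_2connectable G k -> r <= k.

Definition rc2_linear_bound (R : realType) (a : R) : Prop :=
  forall G : sgraph, two_connected G ->
    exists2 r : nat, is_rc2 G r & (r%:R <= a * #|G|%:R)%R.

Definition is_min_rc2_constant (R : realType) (a : R) : Prop :=
  [/\ (0 < a)%R, rc2_linear_bound a &
      forall b : R, (0 < b)%R -> rc2_linear_bound b -> (a <= b)%R].

(* Main.v *)
Require Import Defs.
From HB Require Import structures.
From mathcomp Require Import all_boot all_order all_algebra.
From mathcomp Require Import reals.
From mathcomp Require Import boolp zify.

(* A numbering [r] of the vertices in which [s] and [t] are adjacent and every
   other vertex has a lower and a higher neighbor gives a tree of descending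
   paths to [s] and a tree of ascending paths to [t].  For distinct [u] and [v]
   one finds two internally disjoint paths:
   - if the path ascending from [u] meets the path descending from [v], the
     combination of the two, and the path that descends from [u] to [s], takes
     the edge [st] and descends from [t] to [v] inside the ascending tree;
   - otherwise, the path through the first common vertex of the descending
     paths and the path through that of the ascending paths.
   Colors are vertices.  The ascending edge at [x] gets the color [x], and the
   descending edge at [x] the color of the vertex right below [x] at the time
   when [x] is numbered.  These paths are rainbow if the numbering is built by
   ears each inserted right below its higher end [b], where [b] is the highest
   attachment of the component to which the ear belongs.  This uses [n] colors.

   A last ear from [a] to [b] saves a color: its topmost edge can take the
   color of the ascending edge at [a], unless [a] lies right below [b].  In
   that case some edge at [a] or [b] is redundant and one inducts on the number
   of edges.  What remains is a Hamiltonian cycle, which is the whole graph or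
   has a chord; taking the chord as [st] makes one of the two arcs a last ear
   from [s] to [t].  Conversely, if two edges of a cycle share a color, the ends
   of any third edge are not joined by two rainbow paths. *)

Set Implicit Arguments.
Unset Strict Implicit.
Unset Printing Implicit Defensive.

(* [lia] is slow in large contexts: keep only the inequalities. *)
Ltac rank_lia :=
  repeat match goal with H : is_true (leq _ _) |- _ => revert H end; clear; lia.

(** * Rainbow paths and their concatenation *)

Section RainbowPaths.
Variables (G : sgraph) (K : eqType) (col : {set G} -> K).
Implicit Types (u v x y z : G) (p : seq G) (W : {set G}).

Lemma path_edges_cat u p1 p2 :
  path_edges u (p1 ++ p2) = path_edges u p1 ++ path_edges (last u p1) p2.
Proof. exact: pairmap_cat. Qed.

Lemma last_rev_belast u p : last (last u p) (rev (belast u p)) = u.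
Proof. by case: p => //= x p; rewrite rev_cons last_rcons. Qed.

Lemma cons_rev_belast u p : last u p :: rev (belast u p) = rev (u :: p).
Proof. by rewrite [u :: p]lastI rev_rcons. Qed.

Lemma path_edges_rev u p :
  path_edges (last u p) (rev (belast u p)) = rev (path_edges u p).
Proof.
elim: p u => //= x p IHp u; rewrite [in LHS]rev_cons -cats1 path_edges_cat.
by rewrite [path_edges x p]/path_edges IHp last_rev_belast /= rev_cons -cats1 setUC.
Qed.

Lemma is_path_rev u v p : is_path u v p -> is_path v u (rev (belast u p)).
Proof.
case/and3P => pth /eqP <- up; apply/and3P; split.
- rewrite rev_path; apply: sub_path pth => a b /=; by rewrite adj_sym.
- by rewrite last_rev_belast.
- by rewrite cons_rev_belast rev_uniq.
Qed.

(** Only the vertex set of the path is kept: internal disjointness depends on nothing else, and the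
    notion becomes symmetric in the ends. *)
Definition rainbow_link u v W :=
  exists p, [/\ is_path u v p, uniq [seq col e | e <- path_edges u p]
              & [set y in u :: p] = W].

Lemma rainbow_link_sym u v W : rainbow_link u v W -> rainbow_link v u W.
Proof.
case=> p [pth up <-]; exists (rev (belast u p)); split.
- exact: is_path_rev.
- by case/and3P: pth => _ /eqP <- _; rewrite path_edges_rev map_rev rev_uniq.
- apply/setP => y; case/and3P: pth => _ /eqP <- _.
  by rewrite !inE -in_cons cons_rev_belast mem_rev inE.
Qed.

(** The second path is reversed and appended to the first. As [z] is their only common vertex, no
    vertex repeats, and reversal merely permutes the colors. *)
Lemma rainbow_link_join u v z p p' :
    is_path u z p -> is_path v z p' ->
    (forall y, y \in u :: p -> y \in v :: p' -> y = z) ->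
    uniq ([seq col e | e <- path_edges u p] ++ [seq col e | e <- path_edges v p']) ->
  rainbow_link u v ([set y in u :: p] :|: [set y in v :: p']).
Proof.
move=> pth pth' disj uc; have /and3P[pr /eqP lr ur] := is_path_rev pth'.
case/and3P: pth => pl /eqP ll ul.
case/and3P: (pth') => _ /eqP lv _.
have memr y : (y \in z :: rev (belast v p')) = (y \in v :: p').
  by rewrite -lv cons_rev_belast mem_rev.
exists (p ++ rev (belast v p')); split.
- apply/and3P; split.
  + by rewrite cat_path pl ll.
  + by rewrite last_cat ll lr.
  + move: ur; rewrite -cat_cons cat_uniq ul cons_uniq => /andP[zr ->]; rewrite andbT.
    apply/hasPn => y yr; apply/negP => /= yl.
    have yz : y = z by apply: disj => //; rewrite -memr inE yr orbT.
    by rewrite -yz yr in zr.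
- rewrite path_edges_cat ll map_cat -lv path_edges_rev map_rev.
  set A := map col _; set B := map col _.
  by have /perm_uniq-> : perm_eq (A ++ rev B) (A ++ B) by rewrite perm_cat2l perm_rev.
- apply/setP => y; rewrite in_setU !in_set -memr -cat_cons mem_cat [y \in z :: _]in_cons.
  case: (y \in rev _); rewrite ?orbT // !orbF.
  by case: eqVneq => [->|_]; rewrite ?orbF // orbT -ll mem_last.
Qed.

(** If the two paths were equal, union and intersection of their vertex sets would coincide, which
    the last hypothesis excludes. *)
Lemma two_rainbow_paths u v W1 W2 :
    rainbow_link u v W1 -> rainbow_link u v W2 ->
    W1 :&: W2 = [set u; v] -> (W1 :|: W2 != [set u; v]) ->
  exists p q : seq G,
    [/\ is_path u v p && is_path u v q,
        uniq [seq col e | e <- path_edges u p] && uniq [seq col e | e <- path_edges u q],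
        p != q & internally_disjoint u v p q].
Proof.
case=> p [pp up <-] [q [pq uq <-]] WI WU; exists p, q; split => //.
- by rewrite pp.
- by rewrite up.
- by apply: contraNneq WU => epq; move: WI; rewrite epq setIid setUid => ->.
Qed.

End RainbowPaths.

(** A color in [C] is renamed to its position in [enum C], which is injective and so preserves
    rainbow paths. *)
Lemma vertex_colouring_connectable (G : sgraph) (C : {set G}) (col : {set G} -> G) :
    (forall E, col E \in C) ->
    (forall u v : G, u != v -> exists p q : seq G,
      [/\ is_path u v p && is_path u v q,
        uniq [seq col e | e <- path_edges u p] && uniq [seq col e | e <- path_edges u q],
        p != q & internally_disjoint u v p q]) ->
  rainbow_2connectable G #|C|.
Proof.
move=> colC two; exists (fun E => index (col E) (enum C)).
  by move=> x y _; rewrite cardE index_mem mem_enum.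
move=> u v /two[p [q [pth /andP[up uq] npq dpq]]]; exists p, q; split => //.
have inj l : uniq [seq col e | e <- l] ->
    uniq [seq index (col e) (enum C) | e <- l].
  move=> ul; rewrite (map_comp (index^~ (enum C)) col) map_inj_in_uniq //.
  move=> x y /mapP[e _ ->] /mapP[f _ ->] eqi.
  rewrite -[LHS](nth_index (col e) (s := enum C)) ?mem_enum //.
  by rewrite eqi nth_index // mem_enum.
by rewrite /rainbow !inj.
Qed.

(** * Walks along the iterates of a function *)

Section FunctionalWalks.
Variables (T : finType) (f : T -> T).
Implicit Types (u x y z : T) (p : seq T).

Lemma fconnect_ind (P : T -> Prop) x y :
  P x -> (forall z, P z -> P (f z)) -> fconnect f x y -> P y.
Proof.
move=> Px Pf /iter_findex <-; elim: (findex f x y) => //= n; exact: Pf.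
Qed.

Lemma fconnect_next x y : fconnect f x y -> x != y -> fconnect f (f x) y.
Proof.
move=> /iter_findex; case: (findex f x y) => [/= ->|n <-]; first by rewrite eqxx.
by rewrite iterSr fconnect_iter.
Qed.

Lemma fconnect_comparable u x y :
  fconnect f u x -> fconnect f u y -> fconnect f x y \/ fconnect f y x.
Proof.
move=> /iter_findex <- /iter_findex <-.
case/orP: (leq_total (findex f u x) (findex f u y)) => /subnK <-.
  by left; rewrite iterD fconnect_iter.
by right; rewrite iterD fconnect_iter.
Qed.

Lemma fconnect_path u z : fconnect f u z ->
  exists p, [/\ fpath f u p, last u p = z & uniq (u :: p)].
Proof.
by case/connectP => p /shortenP[p' pth up _ ->]; exists p'.
Qed.

Lemma mem_fpath u p x : fpath f u p -> x \in u :: p ->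
  fconnect f u x /\ fconnect f x (last u p).
Proof.
elim: p u x => [|y p IHp] u x /=; first by rewrite inE => _ /eqP ->.
case/andP => /eqP fu pth; have uy : fconnect f u y by rewrite -fu fconnect1.
rewrite inE => /predU1P[->|/(IHp _ _ pth)[yx xl]].
  split=> //; have [|_ yl] := IHp y y pth; first by rewrite inE eqxx.
  exact: connect_trans uy yl.
by split=> //; apply: connect_trans yx.
Qed.

(** The vertices in [belast u p] are those with an outgoing step on the walk, so they index its
    edges and their colors. *)
Lemma mem_belast_fpath u p x : fpath f u p -> uniq (u :: p) ->
  x \in belast u p -> [/\ f x \in u :: p, fconnect f u x & fconnect f (f x) (last u p)].
Proof.
move=> pth up xp; have xup : x \in u :: p by rewrite lastI mem_rcons inE xp orbT.
have [ux xl] := mem_fpath pth xup; split=> //; last apply: fconnect_next => //.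
  elim: p u pth xp {xup ux xl up} => // y p IHp u /= /andP[/eqP fu pth].
  rewrite !in_cons => /predU1P[->|/(IHp _ pth)]; first by rewrite fu eqxx orbT.
  by rewrite in_cons => ->; rewrite orbT.
apply: contraTneq xp => ->; move: up.
by rewrite lastI rcons_uniq => /andP[].
Qed.

Lemma fixpoint_notin_belast u p w :
  f w = w -> fpath f u p -> uniq (u :: p) -> w \notin belast u p.
Proof.
move=> fw; elim: p u => // y p IHp u /=; case/andP => /eqP fu pth.
case/and3P=> uyp yp up; rewrite inE negb_or IHp ?cons_uniq ?yp // andbT.
by apply: contra uyp => /eqP wu; rewrite inE -fu -wu fw eqxx.
Qed.

End FunctionalWalks.

Lemma fpath_edges (G : sgraph) (f : G -> G) (u : G) p : fpath f u p ->
  path_edges u p = [seq [set x; f x] | x <- belast u p].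
Proof.
by elim: p u => //= y p IHp u /andP[/eqP <- /IHp] ->.
Qed.

(** * Color schemes on a pair of rooted trees *)

Definition tree_related (T : finType) (p1 p2 : T -> T) (u v : T) : Prop :=
  exists z, fconnect p2 u z /\ fconnect p1 v z.

(* [p1] is the parent map of a tree rooted at [s] along which [r] decreases,
   [p2] that of a tree rooted at [t] along which [r] increases.  Colors are
   vertices: [q x] is the color of the edge from [x] to [p1 x], [g x] that of
   the edge from [x] to [p2 x], and [t] that of the edge [st]. *)
Record color_scheme (T : finType) (e : rel T) (s t : T) (r : T -> nat)
    (p1 p2 q g : T -> T) : Prop := ColorScheme {
  cs_st : e s t;
  cs_inj : injective r;
  cs_p1s : p1 s = s;
  cs_p2t : p2 t = t;
  cs_p2s : p2 s != t;
  cs_p1t : p1 t != s;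
  cs_down : forall x, x != s -> [/\ e x (p1 x), r (p1 x) <= r (q x) & r (q x) < r x];
  cs_up : forall x, x != t -> e x (p2 x) /\ r x < r (p2 x);
  cs_both : forall x, x != s -> p2 (p1 x) = x -> g (p1 x) = q x;
  cs_q : forall x x' u, x != s -> x' != s -> q x = q x' -> r x < r x' ->
    fconnect p1 u x -> fconnect p2 u x';
  cs_g_le : forall x, x != t -> r (g x) <= r x;
  cs_g_chain : forall x y, x != t -> y != t -> x != y -> fconnect p2 x y -> g x != g y;
  cs_g_fork : forall x y u v, x != t -> y != t -> x != y -> g x = g y ->
    fconnect p2 u x -> fconnect p2 v y -> tree_related p1 p2 u v \/ tree_related p1 p2 v u;
  cs_q_g : forall u v x y, tree_related p1 p2 u v -> r u < r v -> x != s -> y != t ->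
    fconnect p1 u x -> fconnect p2 v y -> q x != g y
}.

Section SchemeRanks.
Variables (T : finType) (e : rel T) (s t : T) (r : T -> nat) (p1 p2 q g : T -> T).
Hypothesis sch : color_scheme e s t r p1 p2 q g.
Implicit Types x y : T.

Lemma down_rank x y : fconnect p1 x y -> r y <= r x.
Proof.
apply: (fconnect_ind (P := fun y => r y <= r x)) => // z zx.
have [zs|zs] := eqVneq z s; first by rewrite zs (cs_p1s sch) -zs.
have [_ ? ?] := cs_down sch zs; lia.
Qed.

Lemma up_rank x y : fconnect p2 x y -> r x <= r y.
Proof.
apply: (fconnect_ind (P := fun y => r x <= r y)) => // z zx.
have [zs|zs] := eqVneq z t; first by rewrite zs (cs_p2t sch) -zs.
have [_ ?] := cs_up sch zs; lia.
Qed.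

(** Among the vertices reached from [x], one of least rank must be [s], since the parent of any
    other vertex ranks lower. *)
Lemma down_root x : fconnect p1 x s.
Proof.
have xx := connect0 (frel p1) x.
case: (arg_minnP r xx) => y xy ymin; have [<- //|ys] := eqVneq y s.
have [_ ? ?] := cs_down sch ys.
have := ymin (p1 y); rewrite (connect_trans xy (fconnect1 _ _)); lia.
Qed.

Lemma up_root x : fconnect p2 x t.
Proof.
have xx := connect0 (frel p2) x.
case: (arg_maxnP r xx) => y xy ymax; have [<- //|yt] := eqVneq y t.
have [_ ?] := cs_up sch yt.
have := ymax (p2 y); rewrite /= (connect_trans xy (fconnect1 _ _)); lia.
Qed.

Lemma root_min x : r s <= r x.
Proof. exact: down_rank (down_root x). Qed.

Lemma root_max x : r x <= r t.
Proof. exact: up_rank (up_root x). Qed.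

End SchemeRanks.

(** * Two rainbow paths from a color scheme *)

Section SchemeColoring.
Variables (G : sgraph) (s t : G) (r : G -> nat) (p1 p2 q g : G -> G).
Hypothesis sch : color_scheme (@adj G) s t r p1 p2 q g.
Implicit Types (u v x y z : G).

Let inj := cs_inj sch.
Local Notation rel_ := (tree_related p1 p2).

Lemma s_neq_t : s != t.
Proof. by apply/eqP => st; have := cs_st sch; rewrite st adj_irrefl. Qed.

(** An edge may lie in both trees. The ascending tree is tried first, and [cs_both] makes the two
    colors agree. *)
Definition scheme_color (E : {set G}) : G :=
  if E == [set s; t] then t else
  if [pick x | (x != t) && (E == [set x; p2 x])] is Some x then g x else
  if [pick x | (x != s) && (E == [set x; p1 x])] is Some x then q x else t.

Lemma set2_eq (a b x y : G) : [set a; b] = [set x; y] ->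
  (a = x /\ b = y) \/ (a = y /\ b = x).
Proof.
move=> E; have := set21 a b; have := set22 a b; rewrite E !inE.
have := set21 x y; have := set22 x y; rewrite -E !inE.
do 4 (case/pred2P => ?); subst; auto.
Qed.

Lemma scheme_color_st : scheme_color [set t; s] = t.
Proof. by rewrite /scheme_color setUC eqxx. Qed.

Lemma scheme_color_up x : x != t -> scheme_color [set x; p2 x] = g x.
Proof.
move=> xt; have [_ rx] := cs_up sch xt; rewrite /scheme_color.
case: eqP => [/set2_eq[[xs p2x]|[xt' _]]|_]; last 1 first.
- case: pickP => [y /andP[yt /eqP/set2_eq[[-> //]|[xy p2x]]]|/(_ x)].
    by have [_] := cs_up sch yt; rewrite -xy -p2x; lia.
  by rewrite xt eqxx.
- by have := cs_p2s sch; rewrite -xs p2x eqxx.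
- by rewrite xt' eqxx in xt.
Qed.

Lemma scheme_color_down x : x != s -> scheme_color [set x; p1 x] = q x.
Proof.
move=> xs; have [_ rp rq] := cs_down sch xs; rewrite /scheme_color.
case: eqP => [/set2_eq[[xs' _]|[xt p1x]]|_].
- by rewrite xs' eqxx in xs.
- by have := cs_p1t sch; rewrite -xt p1x eqxx.
case: pickP => [y /andP[yt /eqP/set2_eq[[xy p1x]|[xy p1x]]]|_].
- by have [_] := cs_up sch yt; rewrite -p1x -xy; lia.
- by rewrite -p1x; apply: (cs_both sch); rewrite ?p1x.
case: pickP => [y /andP[ys /eqP/set2_eq[[-> //]|[xy p1x]]]|/(_ x)].
  by have [_] := cs_down sch ys; rewrite -xy -p1x; lia.
by rewrite xs eqxx.
Qed.

Lemma up_walk u z : fconnect p2 u z -> exists p,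
  [/\ is_path u z p,
      forall x, x \in u :: p -> fconnect p2 u x /\ fconnect p2 x z,
      forall x, x \in belast u p -> [/\ x != t, fconnect p2 u x, fconnect p2 (p2 x) z & p2 x \in u :: p],
      [seq scheme_color E | E <- path_edges u p] = [seq g x | x <- belast u p] &
      uniq [seq g x | x <- belast u p]].
Proof.
case/fconnect_path => p [pth lp up].
have bt x : x \in belast u p -> x != t.
  by apply: contraTneq => ->; apply: fixpoint_notin_belast pth up; apply: cs_p2t sch.
have mb x : x \in belast u p -> [/\ x != t, fconnect p2 u x, fconnect p2 (p2 x) z & p2 x \in u :: p].
  by move=> xb; have [? ? ?] := mem_belast_fpath pth up xb; rewrite -lp bt.
exists p; split=> //.
- rewrite /is_path lp eqxx up /= andbT; elim: p u pth bt {lp up mb} => //= y p IHp u.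
  case/andP => /eqP <- pth bt; rewrite {}IHp // ?andbT => [|x xp].
    by have [] := cs_up sch (bt u _); rewrite ?inE ?eqxx.
  by apply: bt; rewrite inE xp orbT.
- by move=> x xp; rewrite -lp; apply: mem_fpath.
- rewrite (fpath_edges pth) -map_comp; apply/eq_in_map => x xp /=.
  by rewrite scheme_color_up ?bt.
- rewrite map_inj_in_uniq; first by move: up; rewrite lastI rcons_uniq => /andP[].
  move=> x y xb yb gxy; apply/eqP/contraT => xy.
  have [xt ux _ _] := mb x xb; have [yt uy _ _] := mb y yb.
  have [c|c] := fconnect_comparable ux uy.
    by have := cs_g_chain sch xt yt xy c; rewrite gxy eqxx.
  by rewrite eq_sym in xy; have := cs_g_chain sch yt xt xy c; rewrite gxy eqxx.
Qed.

Lemma down_walk u z : fconnect p1 u z -> exists p,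
  [/\ is_path u z p,
      forall x, x \in u :: p -> fconnect p1 u x /\ fconnect p1 x z,
      forall x, x \in belast u p -> [/\ x != s, fconnect p1 u x, fconnect p1 (p1 x) z & p1 x \in u :: p],
      [seq scheme_color E | E <- path_edges u p] = [seq q x | x <- belast u p] &
      uniq [seq q x | x <- belast u p]].
Proof.
case/fconnect_path => p [pth lp up].
have bs x : x \in belast u p -> x != s.
  by apply: contraTneq => ->; apply: fixpoint_notin_belast pth up; apply: cs_p1s sch.
have mb x : x \in belast u p -> [/\ x != s, fconnect p1 u x, fconnect p1 (p1 x) z & p1 x \in u :: p].
  by move=> xb; have [? ? ?] := mem_belast_fpath pth up xb; rewrite -lp bs.
exists p; split=> //.
- rewrite /is_path lp eqxx up /= andbT; elim: p u pth bs {lp up mb} => //= y p IHp u.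
  case/andP => /eqP <- pth bs; rewrite {}IHp // ?andbT => [|x xp].
    by have [] := cs_down sch (bs u _); rewrite ?inE ?eqxx.
  by apply: bs; rewrite inE xp orbT.
- by move=> x xp; rewrite -lp; apply: mem_fpath.
- rewrite (fpath_edges pth) -map_comp; apply/eq_in_map => x xp /=.
  by rewrite scheme_color_down ?bs.
- rewrite map_inj_in_uniq; first by move: up; rewrite lastI rcons_uniq => /andP[].
  have aux x y : x != s -> y != s -> x != y -> fconnect p1 x y -> q x <> q y.
    move=> xs ys xy /fconnect_next/(_ xy)/(down_rank sch).
    by have [_ rx _] := cs_down sch xs; have [_ _ ry] := cs_down sch ys; move=> ? qxy; rewrite qxy in rx; lia.
  move=> x y xb yb qxy; apply/eqP/contraT => xy.
  have [xs ux _ _] := mb x xb; have [ys uy _ _] := mb y yb.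
  have [c|c] := fconnect_comparable ux uy; first by case: (aux x y).
  by rewrite eq_sym in xy; case: (aux y x).
Qed.

Definition two_links u v := exists W1 W2 : {set G},
  [/\ rainbow_link scheme_color u v W1, rainbow_link scheme_color u v W2,
      W1 :&: W2 = [set u; v] & W1 :|: W2 != [set u; v]].

Lemma two_links_sym u v : two_links u v -> two_links v u.
Proof.
case=> W1 [W2 [l1 l2 I U]]; exists W1, W2.
rewrite (setUC [set v]); split=> //; exact: rainbow_link_sym.
Qed.

Lemma link_ends u v W : rainbow_link scheme_color u v W -> (u \in W) && (v \in W).
Proof.
case=> p [/and3P[_ /eqP lp _] _ <-]; rewrite !in_set inE eqxx /=.
by rewrite -lp mem_last.
Qed.

Lemma two_linksI u v W1 W2 x :
    rainbow_link scheme_color u v W1 -> rainbow_link scheme_color u v W2 ->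
    (forall y, y \in W1 -> y \in W2 -> y = u \/ y = v) ->
    (x \in W1) || (x \in W2) -> x != u -> x != v ->
  two_links u v.
Proof.
move=> l1 l2 I xW xu xv; exists W1, W2; split=> //.
- apply/setP => y; rewrite in_setI in_set2; apply/andP/idP => [[y1 y2]|].
    by case: (I y y1 y2) => ->; rewrite eqxx ?orbT.
  have /andP[u1 v1] := link_ends l1; have /andP[u2 v2] := link_ends l2.
  by case/pred2P => ->.
- by apply/eqP => /setP/(_ x); rewrite in_setU xW in_set2 (negPf xu) (negPf xv).
Qed.

Lemma two_links_related u v : rel_ u v -> r u < r v -> two_links u v.
Proof.
move=> uv ruv; have [z [uz vz]] := uv.
have [p [pth pm pb pc pu]] := up_walk uz.
have [p' [pth' pm' pb' pc' pu']] := down_walk vz.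
have [d [dth dm db dc du]] := down_walk ((down_root sch) u).
have [d' [dth' dm' db' dc' du']] := up_walk ((up_root sch) v).
have ruz := up_rank sch uz; have rvz := down_rank sch vz.
have l1 : rainbow_link scheme_color u v ([set y in u :: p] :|: [set y in v :: p']).
  apply: rainbow_link_join pth pth' _ _.
    move=> y /pm[_ /(up_rank sch) yz] /pm'[_ /(down_rank sch) zy].
    by apply: inj; rank_lia.
  (* Ascending colors rank below [z] and descending ones at or above it. *)
  rewrite pc pc' cat_uniq pu pu' andbT /=; apply/hasPn => c /mapP[y yb ->].
  apply/mapP => -[x xb gx].
  have [ys _ /(down_rank sch) yz _] := pb' y yb; have [xt _ /(up_rank sch) xz _] := pb x xb.
  have [_ ? _] := cs_down sch ys; have [_ ?] := cs_up sch xt.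
  by have := cs_g_le sch xt; rewrite -gx; rank_lia.
have sd' : s \notin v :: d'.
  by apply/negP => /dm'[/(up_rank sch) vs _]; have := (root_min sch) u; rank_lia.
have ts : is_path v s (rcons d' s).
  case/and3P: dth' => pd' /eqP ld' ud'; apply/and3P; split.
  - by rewrite rcons_path pd' ld' /= adj_sym (cs_st sch).
  - by rewrite last_rcons.
  - by rewrite -rcons_cons rcons_uniq sd' ud'.
have l2 : rainbow_link scheme_color u v ([set y in u :: d] :|: [set y in v :: rcons d' s]).
  apply: rainbow_link_join dth ts _ _.
    move=> y /dm[/(down_rank sch) uy _]; rewrite -rcons_cons mem_rcons in_cons => /predU1P[//|].
    by case/dm' => /(up_rank sch) vy _; have := leq_trans vy uy; rewrite leqNgt ruv.
  have ed' : path_edges v (rcons d' s) = rcons (path_edges v d') [set t; s].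
    by rewrite -!cats1 path_edges_cat; case/and3P: dth' => _ /eqP -> _.
  rewrite ed' map_rcons dc dc' scheme_color_st cat_uniq du rcons_uniq du' andbT.
  apply/and3P; split=> //.
    apply/hasPn => c; rewrite mem_rcons inE => /predU1P[->|/mapP[y yb ->]]; apply/mapP => -[x xb].
      have [xs _ _ _] := db x xb; have [_ _] := cs_down sch xs.
      by move=> + tq; rewrite -tq; have := (root_max sch) x; rank_lia.
    have [yt vy _ _] := db' y yb; have [xs ux _ _] := db x xb.
    by move=> gq; have := cs_q_g sch uv ruv xs yt ux vy; rewrite gq eqxx.
  apply/mapP => -[x xb]; have [xt _ _ _] := db' x xb; have [_] := cs_up sch xt.
  by move=> + tq; have := cs_g_le sch xt; rewrite -tq; have := (root_max sch) (p2 x); rank_lia.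
(* On the first path all ranks lie between those of [u] and [v]; on the second none lies strictly
   between. *)
have I y : y \in [set y in u :: p] :|: [set y in v :: p'] ->
    y \in [set y in u :: d] :|: [set y in v :: rcons d' s] -> y = u \/ y = v.
  rewrite !in_setU !in_set => y1 y2.
  have /andP[ruy ryv] : r u <= r y <= r v.
    case/orP: y1 => [/pm|/pm'] [].
      by move=> /(up_rank sch) + /(up_rank sch); rank_lia.
    by move=> /(down_rank sch) + /(down_rank sch); rank_lia.
  have : (r y <= r u) || (r v <= r y).
    case/orP: y2 => [/dm[/(down_rank sch) -> //]|]; rewrite -rcons_cons mem_rcons in_cons.
    by case/predU1P => [->|/dm'[/(up_rank sch) -> _]]; rewrite ?(root_min sch) ?orbT.
  by case/orP => ry; [left|right]; apply: inj; rank_lia.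
have r0 := (root_min sch) u; have r1 := (root_max sch) v.
have sd : s \in u :: d.
  by case/and3P: dth => _ /eqP ls _; rewrite -[X in X \in _]ls mem_last.
have td : t \in v :: d'.
  by case/and3P: dth' => _ /eqP lt _; rewrite -[X in X \in _]lt mem_last.
have in_belast (x y : G) l : is_path x y l -> x != y -> x \in belast x l.
  case: l => [/and3P[_ /= ->]|a l _ _] //; exact: mem_head.
(* A vertex other than the ends is exhibited: [s] or [t] unless these are the ends themselves, and
   then [p1 v] or [p2 u], by [cs_p1t] and [cs_p2s]. *)
have [us|us] := eqVneq u s; last first.
  apply: (two_linksI (x := s) l1 l2 I).
  - by rewrite !in_setU !in_set sd !orbT.
  - by rewrite eq_sym.
  - by apply: contraTneq ruv => <-; rewrite -leqNgt (root_min sch).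
have [vt|vt] := eqVneq v t; last first.
  apply: (two_linksI (x := t) l1 l2 I).
  - by rewrite !in_setU !in_set -rcons_cons mem_rcons (in_cons s) td !orbT.
  - by apply: contraTneq ruv => <-; rewrite -leqNgt (root_max sch).
  - by rewrite eq_sym.
have [zs|zs] := eqVneq z s.
  have vz' : v != z by rewrite zs vt eq_sym s_neq_t.
  have [vs _ _ pv] := pb' v (in_belast _ _ _ pth' vz').
  apply: (two_linksI (x := p1 v) l1 l2 I).
  - by rewrite in_setU !in_set pv orbT.
  - by rewrite us vt (cs_p1t sch).
  - have [_ rp rq] := cs_down sch vs; have := leq_ltn_trans rp rq.
    by apply: contraTneq => ->; rewrite ltnn.
have uz' : u != z by rewrite us eq_sym.
have [ut _ _ pv] := pb u (in_belast _ _ _ pth uz').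
apply: (two_linksI (x := p2 u) l1 l2 I).
- by rewrite in_setU !in_set pv.
- by have [_] := cs_up sch ut; apply: contraTneq => ->; rewrite ltnn.
- by rewrite us vt (cs_p2s sch).
Qed.

Lemma two_links_unrelated u v : ~ rel_ u v -> ~ rel_ v u -> two_links u v.
Proof.
move=> nuv nvu.
have [x] : exists x, [/\ fconnect p1 u x, fconnect p1 v x &
    forall y, fconnect p1 u y -> fconnect p1 v y -> r y <= r x].
  pose P := [pred y | fconnect p1 u y && fconnect p1 v y].
  have P0 : P s by rewrite /= !(down_root sch).
  have [x /andP[ux vx] xm] := arg_maxnP r P0; exists x; split=> // y uy vy.
  by apply: xm; rewrite /= uy.
case=> ux vx xmax.
have [z] : exists z, [/\ fconnect p2 u z, fconnect p2 v z &
    forall y, fconnect p2 u y -> fconnect p2 v y -> r z <= r y].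
  pose P := [pred y | fconnect p2 u y && fconnect p2 v y].
  have P0 : P t by rewrite /= !(up_root sch).
  have [z /andP[uz vz] zm] := arg_minnP r P0; exists z; split=> // y uy vy.
  by apply: zm; rewrite /= uy.
case=> uz vz zmin.
have [p [pth pm pb pc pu]] := down_walk ux.
have [p' [pth' pm' pb' pc' pu']] := down_walk vx.
have [d [dth dm db dc du]] := up_walk uz.
have [d' [dth' dm' db' dc' du']] := up_walk vz.
have l1 : rainbow_link scheme_color u v ([set y in u :: p] :|: [set y in v :: p']).
  apply: rainbow_link_join pth pth' _ _.
    move=> y /pm[uy /(down_rank sch) yx] /pm'[vy _].
    by apply: inj; apply/eqP; rewrite eqn_leq yx xmax.
  rewrite pc pc' cat_uniq pu pu' andbT /=; apply/hasPn => c /mapP[y yb ->].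
  apply/mapP => -[y' yb' qy].
  have [ys vy /(down_rank sch) yx _] := pb' y yb; have [ys' uy' /(down_rank sch) yx' _] := pb y' yb'.
  have [_ ry _] := cs_down sch ys; have [_ _ rq] := cs_down sch ys.
  (* Distinct vertices with the same descending color would relate [u] and [v] by [cs_q]; a single
     one would be a common vertex ranked above [x]. *)
  case: (ltngtP (r y) (r y')) => [ryy|ryy|/inj yy].
  - by apply: nvu; exists y'; split=> //; apply: cs_q sch _ _ _ ys ys' qy ryy vy.
  - by apply: nuv; exists y; split=> //; apply: cs_q sch _ _ _ ys' ys (esym qy) ryy uy'.
  - by subst y'; have := xmax y uy' vy; rank_lia.
have l2 : rainbow_link scheme_color u v ([set y in u :: d] :|: [set y in v :: d']).
  apply: rainbow_link_join dth dth' _ _.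
    move=> y /dm[uy /(up_rank sch) yx] /dm'[vy _].
    by apply: inj; apply/eqP; rewrite eqn_leq yx zmin.
  rewrite dc dc' cat_uniq du du' andbT /=; apply/hasPn => c /mapP[y yb ->].
  apply/mapP => -[y' yb' gy].
  have [yt vy /(up_rank sch) yx _] := db' y yb; have [yt' uy' /(up_rank sch) yx' _] := db y' yb'.
  have [_ ry] := cs_up sch yt.
  have [yy|yy] := eqVneq y y'; first by subst y'; have := zmin y uy' vy; rank_lia.
  by case: (cs_g_fork sch yt yt' yy gy vy uy').
apply: (two_linksI (x := x) l1 l2).
(* A vertex on a descending and an ascending walk from the same end is that end; on walks from
   different ends it would relate [u] and [v]. *)
- move=> y; rewrite !in_setU !in_set => y1 y2.
  case/orP: y1 => [/pm|/pm'] [y1 _]; case/orP: y2 => [/dm|/dm'] [y2 _].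
  + by left; apply: inj; apply/eqP; rewrite eqn_leq (down_rank sch) ?(up_rank sch).
  + by case: nvu; exists y.
  + by case: nuv; exists y.
  + by right; apply: inj; apply/eqP; rewrite eqn_leq (down_rank sch) ?(up_rank sch).
- by rewrite !in_setU !in_set; case/and3P: pth => _ /eqP lx _; rewrite -[X in X \in _]lx mem_last.
- by apply: contra_notN nuv => /eqP xu; exists u; rewrite connect0 -xu; split.
- by apply: contra_notN nvu => /eqP xu; exists v; rewrite connect0 -xu; split.
Qed.

Lemma scheme_two_links u v : u != v -> two_links u v.
Proof.
move=> uv; have [ruv|nuv] := EM (rel_ u v).
  apply: two_links_related => //; case: ruv => z [/(up_rank sch) uz /(down_rank sch) vz].
  by rewrite ltn_neqAle (leq_trans uz vz) andbT; apply: contra uv => /eqP/inj->.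
have [rvu|nvu] := EM (rel_ v u); last exact: two_links_unrelated.
apply: two_links_sym; apply: two_links_related => //; case: rvu => z [/(up_rank sch) vz /(down_rank sch) uz].
by rewrite ltn_neqAle (leq_trans vz uz) andbT; apply: contra uv => /eqP/inj->.
Qed.

Lemma scheme_connectable (C : {set G}) :
    t \in C -> (forall x, x != s -> q x \in C) -> (forall x, x != t -> g x \in C) ->
  rainbow_2connectable G #|C|.
Proof.
move=> tC qC gC; apply: (@vertex_colouring_connectable _ _ scheme_color) => [E|u v uv].
  rewrite /scheme_color; case: eqP => // _.
  case: pickP => [x /andP[xt _]|_]; first exact: gC.
  by case: pickP => [x /andP[xs _]|_]; first exact: qC.
by have [W1 [W2 [l1 l2 I U]]] := scheme_two_links uv; apply: two_rainbow_paths l1 l2 I U.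
Qed.

End SchemeColoring.

(** * Biconnectivity and vertex numberings *)

Definition avoiding (T : finType) (e : rel T) (v : T) : rel T :=
  [rel x y | [&& x != v, y != v & e x y]].

Definition biconnected (T : finType) (e : rel T) : Prop :=
  forall v x y, x != v -> y != v -> connect (avoiding e v) x y.

(** After [v] is removed, the vertices below it still descend to [s] and those above it still ascend
    to [t]; the edge [st] joins the two sides if both occur. *)
Lemma st_numbering_biconnected (T : finType) (e : rel T) (s t : T) (r : T -> nat) :
    symmetric e -> injective r -> e s t ->
    (forall x, x != s -> exists2 y, e x y & r y < r x) ->
    (forall x, x != t -> exists2 y, e x y & r x < r y) ->
  biconnected e.
Proof.
move=> e_sym r_inj est low upp v.
have av x y : x != v -> y != v -> e x y -> connect (avoiding e v) x y.
  by move=> xv yv exy; apply: connect1; apply/and3P.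
have down x : r x < r v -> connect (avoiding e v) x s /\ s != v.
  have [n] := ubnP (r x); elim: n x => // n IHn x ltn rxv.
  have neqv y : r y < r v -> y != v by apply: contraTneq => ->; rewrite ltnn.
  have [<-|xs] := eqVneq x s; first by split; rewrite ?connect0 ?neqv.
  have [y exy ryx] := low x xs; have ryv := ltn_trans ryx rxv.
  have [|cy sv] := IHn y _ ryv; first by rank_lia.
  by split=> //; apply: connect_trans cy; apply: av exy; apply: neqv.
have up x : r v < r x -> connect (avoiding e v) x t /\ t != v.
  (* Induction on the distance from the maximal rank. *)
  have [n] := ubnP (\max_y r y - r x); elim: n x => // n IHn x ltn rvx.
  have neqv y : r v < r y -> y != v by apply: contraTneq => ->; rewrite ltnn.
  have [<-|xt] := eqVneq x t; first by split; rewrite ?connect0 ?neqv.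
  have [y exy rxy] := upp x xt; have rvy := ltn_trans rvx rxy.
  have ry : r y <= \max_y r y by exact: leq_bigmax.
  have [|cy sv] := IHn y _ rvy; first by move: ltn ry; set M := \max_y r y; rank_lia.
  by split=> //; apply: connect_trans cy; apply: av exy; apply: neqv.
have csym : connect_sym (avoiding e v).
  by apply: sym_connect_sym => x y; rewrite /avoiding /= e_sym andbCA.
have ends x : x != v ->
    connect (avoiding e v) x s /\ s != v \/ connect (avoiding e v) x t /\ t != v.
  by case: (ltngtP (r x) (r v)) => [/down|/up|/r_inj->]; [left|right|rewrite eqxx].
move=> x y /ends[[xs sv]|[xt tv]] /ends[[ys sv']|[yt tv']].
- by apply: connect_trans xs _; rewrite csym.
- by apply: connect_trans xs (connect_trans (av _ _ sv tv' est) _); rewrite csym.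
- by apply: connect_trans xt _; rewrite csym; apply: connect_trans ys (av _ _ sv' tv est).
- by apply: connect_trans xt _; rewrite csym.
Qed.

Definition delete_edge (T : finType) (e : rel T) (x y : T) : rel T :=
  [rel u v | e u v && ([set u; v] != [set x; y])].

Lemma set2_neq (T : finType) (a b x y : T) :
  (a != x) || (b != y) -> (a != y) || (b != x) -> [set a; b] != [set x; y].
Proof.
move=> H1 H2; apply/eqP => E; have := set21 a b; have := set22 a b; rewrite E !in_set2.
have := set21 x y; have := set22 x y; rewrite -E !in_set2.
by do 4 (case/pred2P => ?); subst; rewrite ?eqxx in H1 H2.
Qed.

Lemma delete_edge_sym (T : finType) (e : rel T) (x y : T) :
  symmetric e -> symmetric (delete_edge e x y).
Proof. by move=> e_sym u v; rewrite /delete_edge /= e_sym setUC. Qed.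

(** * Partial schemes and links outside their vertex set *)

Definition outside (T : finType) (e : rel T) (S : {set T}) : rel T :=
  [rel x y | [&& x \notin S, y \notin S & e x y]].

(** The trivial case [u = v] lets [ps_cap] bound the descendants of [x] themselves; any other link
    has an interior vertex outside [S]. *)
Definition linked (T : finType) (e : rel T) (S : {set T}) (u v : T) : Prop :=
  u = v \/ exists x y, [/\ x \notin S, y \notin S, e u x, e y v & connect (outside e S) x y].

(* [ps_block] says that the vertices numbered between [q x] and [x] are below [x]
   in the ascending tree.  [ps_cap] makes this apply to the descendants of [x]
   when [x'] has the same color [q x'] = [q x], including those added later. *)
Record partial_scheme (T : finType) (e : rel T) (s t : T) (S : {set T}) (r : T -> nat)
    (p1 p2 q : T -> T) : Prop := PartialScheme {
  ps_s : s \in S;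
  ps_t : t \in S;
  ps_st : e s t;
  ps_inj : {in S &, injective r};
  ps_p1s : p1 s = s;
  ps_p2t : p2 t = t;
  ps_p2s : p2 s != t;
  ps_p1t : p1 t != s;
  ps_down : forall x, x \in S -> x != s ->
    [/\ p1 x \in S, q x \in S, e x (p1 x), r (p1 x) <= r (q x) & r (q x) < r x];
  ps_up : forall x, x \in S -> x != t -> [/\ p2 x \in S, e x (p2 x) & r x < r (p2 x)];
  ps_both : forall x, x \in S -> x != s -> p2 (p1 x) = x -> q x = p1 x;
  ps_block : forall x y, x \in S -> y \in S -> x != s -> r (q x) < r y -> r y <= r x ->
    fconnect p2 y x;
  ps_cap : forall x x' u v, x \in S -> x' \in S -> u \in S -> v \in S ->
    x != s -> x' != s -> q x = q x' -> r x < r x' -> fconnect p1 u x ->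
    linked e S u v -> r v <= r x'
}.

Lemma partial_down_rank (T : finType) (e : rel T) s t S r p1 p2 q x y :
    partial_scheme e s t S r p1 p2 q -> x \in S -> fconnect p1 x y ->
  y \in S /\ r y <= r x.
Proof.
move=> P xS; apply: (fconnect_ind (P := fun y => y \in S /\ r y <= r x)) => // z [zS zx].
have [zs|zs] := eqVneq z s; first by rewrite zs (ps_p1s P) -zs.
by have [pS _ _ ? ?] := ps_down P zS zs; split=> //; rank_lia.
Qed.

Lemma partial_up_rank (T : finType) (e : rel T) s t S r p1 p2 q x y :
    partial_scheme e s t S r p1 p2 q -> x \in S -> fconnect p2 x y ->
  y \in S /\ r x <= r y.
Proof.
move=> P xS; apply: (fconnect_ind (P := fun y => y \in S /\ r x <= r y)) => // z [zS zx].
have [zt|zt] := eqVneq z t; first by rewrite zt (ps_p2t P) -zt.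
by have [pS _ ?] := ps_up P zS zt; split=> //; rank_lia.
Qed.

(** Applying [ps_cap] to trivial links and then [ps_block] gives [cs_q]. With the identity as [g],
    ascending colors are distinct, and a comparison of ranks gives [cs_q_g]. *)
Lemma partial_scheme_full (T : finType) (e : rel T) s t r p1 p2 q :
    partial_scheme e s t setT r p1 p2 q ->
  color_scheme e s t r p1 p2 q id.
Proof.
move=> P; split=> //.
- exact: ps_st P.
- by move=> x y; apply: (ps_inj P); rewrite inE.
- exact: ps_p1s P.
- exact: ps_p2t P.
- exact: ps_p2s P.
- exact: ps_p1t P.
- by move=> x xs; have [] := ps_down P (in_setT x) xs.
- by move=> x xt; have [] := ps_up P (in_setT x) xt.
- by move=> x xs /(ps_both P (in_setT x) xs).
- move=> x x' u xs xs' qx rx ux; apply: (ps_block P); rewrite ?inE // -?qx.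
    have [_ _ _ _ rq] := ps_down P (in_setT x) xs; apply: leq_trans rq _.
    by have [] := partial_down_rank P (in_setT u) ux.
  by apply: (ps_cap P) qx rx ux _; rewrite ?inE //; left.
- by move=> x y u v _ _ /eqP.
- move=> u v x y _ ruv xs yt ux vy; apply: contraTneq ruv => /= qxy.
  have [_ rx] := partial_down_rank P (in_setT u) ux.
  have [_ ry] := partial_up_rank P (in_setT v) vy.
  have [_ _ _ _ rq] := ps_down P (in_setT x) xs; rewrite qxy in rq.
  by rewrite -leqNgt; rank_lia.
Qed.

(* The interior of a path from [a] to [b] outside [S], where [b] is the highest
   vertex of [S] attached to the component of this interior, and [c] is the
   vertex of [S] right below [b]. *)
Record insertable_ear (T : finType) (e : rel T) (S : {set T}) (r : T -> nat)
    (ear : seq T) (a b c : T) : Prop := InsertableEar {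
  ie_neq0 : ear != [::];
  ie_uniq : uniq ear;
  ie_outside : forall x, x \in ear -> x \notin S;
  ie_path : path e a (rcons ear b);
  ie_a : a \in S;
  ie_b : b \in S;
  ie_ab : r a < r b;
  ie_b_max : forall y v, y \notin S -> v \in S ->
    connect (outside e S) (head a ear) y -> e y v -> r v <= r b;
  ie_c : c \in S;
  ie_cb : r c < r b;
  ie_c_pred : forall y, y \in S -> r y < r b -> r y <= r c
}.

(** * Insertion of an ear into a partial scheme *)

Section Ear.
Variables (T : finType) (e : rel T) (s t : T) (S : {set T}) (r : T -> nat).
Variables (p1 p2 q : T -> T) (ear : seq T) (a b c : T).
Hypothesis e_sym : symmetric e.
Hypothesis P : partial_scheme e s t S r p1 p2 q.
Hypothesis E : insertable_ear e S r ear a b c.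

Let ear0 := ie_neq0 E.
Let earU := ie_uniq E.
Let earS := ie_outside E.
Let earE := ie_path E.
Let aS := ie_a E.
Let bS := ie_b E.
Let rab := ie_ab E.
Let b_max := ie_b_max E.
Let cS := ie_c E.
Let rcb := ie_cb E.
Let c_pred := ie_c_pred E.

(** Raising [b] and all higher vertices by the length of the ear frees the ranks right below [b],
    which the ear fills in the direction from [a] to [b]. *)
Definition ear_rank x :=
  if x \in ear then r b + index x ear else if r x < r b then r x else r x + size ear.
Definition ear_p1 x := if x \in ear then nth a (a :: ear) (index x ear) else p1 x.
Definition ear_p2 x := if x \in ear then nth b ear (index x ear).+1 else p2 x.
(** On the ear this differs from [ear_p1] only at the first vertex, which descends to [a] but has
    the color [c], the vertex right below it in the new numbering. *)
Definition ear_q x := if x \in ear then nth c (c :: ear) (index x ear) else q x.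
Local Notation r' := ear_rank.
Local Notation p1' := ear_p1.
Local Notation p2' := ear_p2.
Local Notation q' := ear_q.
Local Notation S' := (S :|: [set x in ear]).

Lemma oldF x : x \in S -> (x \in ear) = false.
Proof. by move=> xS; apply/negP => /earS; rewrite xS. Qed.

Lemma ear_p1_old x : x \in S -> p1' x = p1 x.
Proof. by rewrite /ear_p1 => /oldF->. Qed.
Lemma ear_p2_old x : x \in S -> p2' x = p2 x.
Proof. by rewrite /ear_p2 => /oldF->. Qed.
Lemma ear_q_old x : x \in S -> q' x = q x.
Proof. by rewrite /ear_q => /oldF->. Qed.

Lemma ear_downP x : x \in ear ->
  [/\ index x ear = 0, q' x = c & p1' x = a] \/
  exists y, [/\ y \in ear, index x ear = (index y ear).+1, q' x = y & p1' x = y].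
Proof.
move=> xe; rewrite /ear_q /ear_p1 xe; have := xe; rewrite -index_mem.
case: (index x ear) => [|i] lti; [by left | right; exists (nth a ear i) => /=].
have lti' := ltnW lti; rewrite mem_nth // index_uniq //; split=> //.
exact: set_nth_default.
Qed.

Lemma ear_upP x : x \in ear ->
  ((index x ear).+1 = size ear /\ p2' x = b) \/
  exists y, [/\ y \in ear, index y ear = (index x ear).+1 & p2' x = y].
Proof.
move=> xe; rewrite /ear_p2 xe; have := xe; rewrite -index_mem => lti.
have [lt2|le2] := ltnP (index x ear).+1 (size ear).
  by right; exists (nth b ear (index x ear).+1); rewrite mem_nth ?index_uniq.
by left; rewrite nth_default //; split=> //; apply/eqP; rewrite eqn_leq lti.
Qed.

(** The letters [o] and [e] in these names mark old vertices and ear vertices. The shift keeps the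
    order of the old ones. *)
Lemma ear_lt_oo x y : x \in S -> y \in S -> (r' x < r' y) = (r x < r y).
Proof.
move=> /oldF xS /oldF yS; rewrite /ear_rank xS yS.
by case: (ltnP (r x) (r b)); case: (ltnP (r y) (r b)) => /=; rank_lia.
Qed.

Lemma ear_le_oo x y : x \in S -> y \in S -> (r' x <= r' y) = (r x <= r y).
Proof. by move=> xS yS; rewrite leqNgt ear_lt_oo // -leqNgt. Qed.

Lemma ear_lt_eo x y : x \in ear -> y \in S -> (r' x < r' y) = (r b <= r y).
Proof.
move=> xe /oldF yS; rewrite /ear_rank xe yS; have := xe; rewrite -index_mem.
by case: (ltnP (r y) (r b)) => /=; rank_lia.
Qed.

Lemma ear_lt_oe x y : x \in S -> y \in ear -> (r' x < r' y) = (r x < r b).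
Proof.
move=> /oldF xS ye; rewrite /ear_rank ye xS; have := ye; rewrite -index_mem.
by case: (ltnP (r x) (r b)) => /=; rank_lia.
Qed.

Lemma ear_le_oe x y : x \in S -> y \in ear -> (r' x <= r' y) = (r x < r b).
Proof. by move=> xS ye; rewrite leqNgt ear_lt_eo // -ltnNge. Qed.

Lemma ear_lt_ee x y : x \in ear -> y \in ear -> (r' x < r' y) = (index x ear < index y ear).
Proof. by move=> xe ye; rewrite /ear_rank ye xe ltn_add2l. Qed.

Lemma ear_inj : {in S' &, injective r'}.
Proof.
move=> x y; rewrite !inE => xS yS rxy.
have lxy : (r' x < r' y) = false by rewrite rxy ltnn.
have lyx : (r' y < r' x) = false by rewrite rxy ltnn.
case/orP: xS => xS; case/orP: yS => yS; move: lxy lyx.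
- rewrite !ear_lt_oo // => *; apply: (ps_inj P) => //; lia.
- rewrite ear_lt_oe // ear_lt_eo //; rank_lia.
- rewrite ear_lt_eo // ear_lt_oe //; rank_lia.
- rewrite !ear_lt_ee // => *; have ii : index x ear = index y ear by lia.
  by rewrite -(nth_index x xS) ii nth_index.
Qed.

Lemma ear_edge_down x : x \in ear -> e x (p1' x).
Proof.
move=> xe; rewrite /ear_p1 xe e_sym; move/(pathP a)/(_ (index x ear)): earE.
rewrite size_rcons ltnS index_size => /(_ isT).
rewrite nth_rcons index_mem xe nth_index //.
by rewrite -rcons_cons nth_rcons /= ltnS index_size.
Qed.

Lemma ear_edge_up x : x \in ear -> e x (p2' x).
Proof.
move=> xe; rewrite /ear_p2 xe; move/(pathP b)/(_ (index x ear).+1): earE.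
have := xe; rewrite -index_mem size_rcons ltnS => lti /(_ lti).
rewrite /= nth_rcons lti nth_index // nth_rcons.
case: ltnP => // le2; rewrite [nth b ear _]nth_default //.
by case: eqP.
Qed.

Lemma ear_p1_conn_old u x : u \in S -> fconnect p1' u x -> x \in S /\ fconnect p1 u x.
Proof.
move=> uS; apply: (fconnect_ind (P := fun x => x \in S /\ fconnect p1 u x)) => // z [zS uz].
rewrite ear_p1_old //; split; last exact: connect_trans uz (fconnect1 _ _).
by have [->|zs] := eqVneq z s; [rewrite (ps_p1s P) (ps_s P) | have [] := ps_down P zS zs].
Qed.

Lemma ear_p1_conn u x : u \in S -> fconnect p1 u x -> fconnect p1' u x.
Proof.
move=> uS /(fconnect_ind (P := fun x => x \in S /\ fconnect p1' u x)); case=> //.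
move=> z [zS uz]; rewrite -ear_p1_old //; split; last exact: connect_trans uz (fconnect1 _ _).
rewrite ear_p1_old //.
by have [->|zs] := eqVneq z s; [rewrite (ps_p1s P) (ps_s P) | have [] := ps_down P zS zs].
Qed.

Lemma ear_p2_conn_old u x : u \in S -> fconnect p2' u x -> x \in S /\ fconnect p2 u x.
Proof.
move=> uS; apply: (fconnect_ind (P := fun x => x \in S /\ fconnect p2 u x)) => // z [zS uz].
rewrite ear_p2_old //; split; last exact: connect_trans uz (fconnect1 _ _).
by have [->|zt] := eqVneq z t; [rewrite (ps_p2t P) (ps_t P) | have [] := ps_up P zS zt].
Qed.

Lemma ear_p2_conn u x : u \in S -> fconnect p2 u x -> fconnect p2' u x.
Proof.
move=> uS /(fconnect_ind (P := fun x => x \in S /\ fconnect p2' u x)); case=> //.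
move=> z [zS uz]; rewrite -ear_p2_old //; split; last exact: connect_trans uz (fconnect1 _ _).
rewrite ear_p2_old //.
by have [->|zt] := eqVneq z t; [rewrite (ps_p2t P) (ps_t P) | have [] := ps_up P zS zt].
Qed.

(** A descending walk leaves the ear only from its first vertex, towards [a]. *)
Lemma ear_p1_conn_new u x : u \in ear -> fconnect p1' u x ->
  x \in ear \/ x \in S /\ fconnect p1 a x.
Proof.
move=> ue; apply: (fconnect_ind (P := fun x => x \in ear \/ x \in S /\ fconnect p1 a x)); first by left.
move=> z [/ear_downP[[_ _ ->]|[y [ye _ _ ->]]]|[zS az]]; [by right | by left | right].
have az' := connect_trans (ear_p1_conn aS az) (fconnect1 _ _).
exact: ear_p1_conn_old az'.
Qed.

Lemma ear_conn_a u : u \in ear -> fconnect p1' u a.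
Proof.
have [n] := ubnP (index u ear); elim: n u => // n IHn u ltn ue.
case: (ear_downP ue) => [[_ _ <-]|[y [ye iy _ py]]]; first exact: fconnect1.
by apply: connect_trans (IHn y _ ye); [rewrite -py fconnect1 | lia].
Qed.

Lemma ear_conn_b u : u \in ear -> fconnect p2' u b.
Proof.
have [n] := ubnP (size ear - index u ear); elim: n u => // n IHn u ltn ue.
case: (ear_upP ue) => [[_ <-]|[y [ye iy py]]]; first exact: fconnect1.
have lti : index y ear < size ear by rewrite index_mem.
by apply: connect_trans (IHn y _ ye); [rewrite -py fconnect1 | lia].
Qed.

Lemma outsideS : subrel (outside e S') (outside e S).
Proof.
move=> x y /and3P[]; rewrite !inE !negb_or => /andP[xS _] /andP[yS _] exy.
by apply/and3P; split.
Qed.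

Lemma outside_connectS x y : connect (outside e S') x y -> connect (outside e S) x y.
Proof. by apply: connect_sub x y => x y /outsideS/connect1. Qed.

Lemma outside_sym : symmetric (outside e S).
Proof. by move=> x y; rewrite /outside /= e_sym andbCA. Qed.

Lemma ear_connected u v : u \in ear -> v \in ear -> connect (outside e S) u v.
Proof.
move=> ue ve; have sym := sym_connect_sym outside_sym.
have top n' w : index w ear = n' -> w \in ear -> connect (outside e S) w (head a ear).
  elim: n' w => [|n' IHn] w iw we.
    by have -> : w = head a ear by rewrite -nth0 -iw nth_index.
  case: (ear_downP we) => [[]|[y [ye iy _ py]]]; first by rewrite iw.
  apply: connect_trans (IHn y _ ye); last by move: iw; rewrite iy => -[].
  by apply: connect1; rewrite /outside /= !earS // -py ear_edge_down.
apply: connect_trans (top _ u erefl ue) _.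
by rewrite sym; apply: top erefl ve.
Qed.

Lemma ear_first : [/\ head a ear \in ear, e a (head a ear) & q' (head a ear) = c].
Proof.
rewrite /ear_q; case: ear ear0 earE => //= x l _ /andP[-> _].
by rewrite mem_head eqxx.
Qed.


Lemma ear_last : [/\ last a ear \in ear, e (last a ear) b & p2' (last a ear) = b].
Proof.
rewrite /ear_p2; move: earU earE; case/lastP: ear ear0 => // l x _ ul.
rewrite rcons_path last_rcons mem_rcons mem_head => /andP[_ exb]; split=> //.
rewrite nth_default // -{2}[rcons l x]cats1 index_cat.
by move: ul; rewrite rcons_uniq => /andP[/negPf -> _]; rewrite /= eqxx addn0 size_rcons.
Qed.

Lemma linked_a_b : linked e S a b.
Proof.
have [xe eax _] := ear_first; have [ye eyb _] := ear_last.
by right; exists (head a ear), (last a ear); split; rewrite ?earS // ear_connected.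
Qed.

(** The ear lies in one component of the complement of [S], so the link can be rerouted to start at
    [a]. *)
Lemma linked_from_ear u v : u \in ear -> v \in S -> linked e S' u v -> linked e S a v.
Proof.
move=> ue vS [uv|[x [y [xS yS eux eyv cxy]]]]; first by have := earS ue; rewrite uv vS.
have [he eah _] := ear_first; right; exists (head a ear), y.
move: xS yS; rewrite !inE !negb_or => /andP[xS _] /andP[yS _]; split=> //; first exact: earS.
apply: connect_trans (ear_connected he ue) _.
apply: connect_trans (connect1 _) (outside_connectS cxy).
by rewrite /outside /= earS // xS.
Qed.

(** Here [v] is an attachment of the component of the ear, and [b] is the highest one. *)
Lemma linked_from_ear_le u v : u \in ear -> v \in S -> linked e S' u v -> r v <= r b.
Proof.
move=> ue vS [uv|[x [y [xS yS eux eyv cxy]]]]; first by have := earS ue; rewrite uv vS.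
have [he _ _] := ear_first.
move: xS yS; rewrite !inE !negb_or => /andP[xS _] /andP[yS _]; apply: (b_max yS vS _ eyv).
apply: connect_trans (ear_connected he ue) _.
apply: connect_trans (connect1 _) (outside_connectS cxy).
by rewrite /outside /= earS // xS.
Qed.

Lemma linked_to_ear u v : u \in S -> v \in ear -> linked e S' u v -> linked e S u b.
Proof.
move=> uS ve [uv|[x [y [xS yS eux eyv cxy]]]]; first by have := earS ve; rewrite -uv uS.
have [le elb _] := ear_last; right; exists x, (last a ear).
move: xS yS; rewrite !inE !negb_or => /andP[xS _] /andP[yS _]; split=> //; first exact: earS.
apply: connect_trans (outside_connectS cxy) _.
apply: connect_trans (connect1 _) (ear_connected ve le).
by rewrite /outside /= yS earS.
Qed.

Lemma linked_old u v : linked e S' u v -> linked e S u v.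
Proof.
case=> [->|[x [y [xS yS eux eyv cxy]]]]; [by left | right; exists x, y].
move: xS yS; rewrite !inE !negb_or => /andP[xS _] /andP[yS _]; split=> //.
exact: outside_connectS.
Qed.

Lemma p1_closed x : x \in S -> p1 x \in S.
Proof. by move=> xS; have [] := ear_p1_conn_old xS (fconnect1 p1' x); rewrite ear_p1_old. Qed.

Lemma p2_closed x : x \in S -> p2 x \in S.
Proof. by move=> xS; have [] := ear_p2_conn_old xS (fconnect1 p2' x); rewrite ear_p2_old. Qed.

Lemma ear_cap x x' u v : x \in S' -> x' \in S' -> u \in S' -> v \in S' ->
    x != s -> x' != s -> q' x = q' x' -> r' x < r' x' -> fconnect p1' u x ->
    linked e S' u v -> r' v <= r' x'.
Proof.
have capE (y w : T) : y \in ear -> w \in S -> r b <= r w -> r' y <= r' w.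
  by move=> ye wS rw; rewrite ltnW // ear_lt_eo.
rewrite !in_setU !in_set => xS xS' uS vS xs xs' qxx rxx ux uv.
case/orP: xS => [xS|xe]; case/orP: xS' => [xS'|xe'].
(* Both vertices are old. A link that starts in the ear is rerouted through [a], and one that ends
   there through [b], below which the ear lies. *)
- have qq : q x = q x' by move: qxx; rewrite !ear_q_old.
  rewrite ear_lt_oo // in rxx; case/orP: uS => [uS|ue].
    have [_ ux'] := ear_p1_conn_old uS ux; case/orP: vS => [vS|ve].
      by rewrite ear_le_oo //; apply: (ps_cap P) qq rxx ux' (linked_old uv).
    apply: capE => //; apply: (ps_cap P) qq rxx ux' _ => //.
    exact: linked_to_ear ve uv.
  have [xe|[_ ax]] := ear_p1_conn_new ue ux; first by rewrite (oldF xS) in xe.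
  case/orP: vS => [vS|ve].
    rewrite ear_le_oo //; apply: (ps_cap P) qq rxx ax _ => //.
    exact: linked_from_ear ue vS uv.
  apply: capE => //; apply: (ps_cap P) qq rxx ax _ => //.
  exact: linked_a_b.
(* The only possible common color is [c], but then the old vertex [x] would rank strictly between
   [c] and [b]. *)
- have [_ qS _ _ rqx] := ps_down P xS xs; move: qxx; rewrite ear_q_old // => qxx.
  case: (ear_downP xe') => [[_ qc _]|[y [ye _ qy _]]]; last first.
    by have := oldF qS; rewrite qxx qy ye.
  have rxb : r x < r b by rewrite -(ear_lt_oe xS xe').
  by have := c_pred xS rxb; rewrite leqNgt -qc -qxx rqx.
(* Now [x] is the first ear vertex, and only ear vertices descend to it. Their component attaches
   nowhere above [b], hence nowhere above [x']. *)
- case: (ear_downP xe) => [[_ qc _]|[y [ye _ qy _]]]; last first.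
    have [_ qS _ _ _] := ps_down P xS' xs'.
    by have := oldF qS; rewrite -(ear_q_old xS') -qxx qy ye.
  rewrite (ear_lt_eo xe xS') in rxx; case/orP: uS => [uS|ue].
    by have [xS _] := ear_p1_conn_old uS ux; rewrite (oldF xS) in xe.
  case/orP: vS => [vS|ve]; last exact: capE.
  by rewrite ear_le_oo //; apply: leq_trans rxx; apply: linked_from_ear_le ue vS uv.
(* Within the ear, all descending colors are distinct. *)
- rewrite (ear_lt_ee xe xe') in rxx.
  case: (ear_downP xe) => [[ix qc _]|[y [ye ix qy _]]];
    case: (ear_downP xe') => [[ix' qc' _]|[y' [ye' ix' qy' _]]].
  + by move: rxx; rewrite ix ix'.
  + by have := oldF cS; rewrite -qc qxx qy' ye'.
  + by have := oldF cS; rewrite -qc' -qxx qy ye.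
  + by move: rxx; rewrite ix ix' -qy -qy' qxx ltnn.
Qed.

(** If the block of an old vertex meets the ear, it contains [b], to which the ear ascends. The
    block of an ear vertex is that vertex alone. *)
Lemma ear_block x y : x \in S' -> y \in S' -> x != s -> r' (q' x) < r' y -> r' y <= r' x ->
  fconnect p2' y x.
Proof.
rewrite !in_setU !in_set => xS yS xs; case/orP: xS => [xS|xe].
  have [_ qS _ _ rqx] := ps_down P xS xs; rewrite ear_q_old //.
  case/orP: yS => [yS|ye].
    rewrite ear_lt_oo // ear_le_oo // => r1 r2.
    by apply: ear_p2_conn => //; apply: (ps_block P).
  rewrite [r' y <= r' x]leqNgt !ear_lt_oe // -leqNgt => r1 r2.
  apply: connect_trans (ear_conn_b ye) _; apply: ear_p2_conn => //.
  exact: (ps_block P).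
case: (ear_downP xe) => [[ix -> _]|[z [ze ix -> _]]]; case/orP: yS => [yS|ye].
- rewrite ear_lt_oo // ear_le_oe // => r1 r2.
  by have := c_pred yS r2; rewrite leqNgt r1.
- rewrite ear_lt_oe // [r' y <= r' x]leqNgt ear_lt_ee // ix -leqNgt leqn0 => _ /eqP iy.
  by rewrite -(nth_index x ye) iy -ix nth_index.
- by rewrite ear_lt_eo // ear_le_oe // [r b <= _]leqNgt => /negPf->.
- rewrite [r' y <= r' x]leqNgt !ear_lt_ee // ix -leqNgt => i1 i2.
  have iy : index y ear = index x ear by apply/eqP; rewrite eqn_leq ix i2 i1.
  by rewrite -(nth_index x ye) iy nth_index.
Qed.

Lemma ear_partial_scheme : partial_scheme e s t S' r' p1' p2' q'.
Proof.
have [sS tS] := (ps_s P, ps_t P).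
split; rewrite ?inE ?ear_p1_old ?ear_p2_old ?sS ?tS //.
- exact: ps_st P.
- exact: ear_inj.
- exact: ps_p1s P.
- exact: ps_p2t P.
- exact: ps_p2s P.
- exact: ps_p1t P.
- move=> x; rewrite !in_setU !in_set; have [xS _ xs|_ /= xe _] := boolP (x \in S).
    have [pS qS ex rpq rqx] := ps_down P xS xs.
    by rewrite ear_p1_old // ear_q_old // ear_le_oo // ear_lt_oo // pS qS.
  have ex := ear_edge_down xe; case: (ear_downP xe) => [[_ qc pa]|[y [ye iy qy py]]].
    by rewrite pa in ex; rewrite pa qc ear_le_oo // ear_lt_oe // aS cS c_pred.
  by rewrite py in ex; rewrite qy py ear_lt_ee // iy ye orbT ltnSn.
- move=> x; rewrite !in_setU !in_set; have [xS _ xt|_ /= xe _] := boolP (x \in S).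
    have [pS ex rx] := ps_up P xS xt.
    by rewrite ear_p2_old // ear_lt_oo // pS.
  have ex := ear_edge_up xe; case: (ear_upP xe) => [[_ pb]|[y [ye iy py]]].
    by rewrite pb in ex; rewrite pb ear_lt_eo // bS leqnn.
  by rewrite py in ex; rewrite py ear_lt_ee // iy ye orbT ltnSn.
- move=> x; rewrite in_setU in_set; have [xS _ xs|_ /= xe _] := boolP (x \in S).
    by rewrite ear_p1_old // ear_q_old // ear_p2_old ?p1_closed //; apply: (ps_both P).
  case: (ear_downP xe) => [[_ qc pa]|[y [ye iy qy py]] _]; last by rewrite qy py.
  by rewrite pa ear_p2_old // => pax; have := oldF (p2_closed aS); rewrite pax xe.
- exact: ear_block.
- exact: ear_cap.
Qed.

(** * The last ear: saving a color or deleting an edge *)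

Let w := last a ear.

Definition ear_g x := if x == w then a else x.

(* The last ear saves the color of its topmost edge, which can take that of the
   edge going up from [a]. *)
Lemma ear_color_scheme : S' = setT -> size ear = 1 \/ c != a ->
  [/\ color_scheme e s t r' p1' p2' q' ear_g, t != w,
      forall x, x != s -> q' x != w & forall x, ear_g x != w].
Proof.
move=> ST sac; have PT := ear_partial_scheme; rewrite ST in PT.
have F := partial_scheme_full PT; have [we _ p2w] := ear_last; rewrite -/w in we p2w.
have aw x : x \in ear -> (x == a) = false.
  by move=> xe; apply: contraFF (oldF aS) => /eqP <-.
have inST x : x \in S \/ x \in ear.
  by have := in_setT x; rewrite -ST inE in_set => /orP.
have to_w u : fconnect p2' u w -> u \in ear.
  case: (inST u) => // uS /(ear_p2_conn_old uS)[wS _]; by rewrite (oldF wS) in we.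
have qw x : x != s -> q' x != w.
  move=> xs; case: (inST x) => [xS|xe].
    have [_ qS _ _ _] := ps_down P xS xs; rewrite ear_q_old //.
    by apply: contraTneq qS => ->; apply: earS.
  case: (ear_downP xe) => [[_ -> _]|[y [ye iy qy py]]].
    by apply: contraTneq cS => ->; apply: earS.
  rewrite qy; apply/eqP => yw; case: (ear_upP ye) => [[sy _]|[z [ze _ pz]]].
    have lx : index x ear < size ear by rewrite index_mem.
    by rewrite iy sy ltnn in lx.
  by have := oldF bS; rewrite -p2w -yw pz ze.
have rga x : r' (ear_g x) <= r' x.
  by rewrite /ear_g; case: eqP => // ->; rewrite ear_le_oe.
split=> //; last 1 first.
- by move=> x; rewrite /ear_g; case: (eqVneq x w) => // _; rewrite eq_sym -/w aw.
- split; try by case: F.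
  + move=> x xs pp; have px : p1' x = q' x := cs_both F xs pp.
    by rewrite /ear_g px (negPf (qw x xs)).
  (* The vertices [w] and [a] share a color, but no ascending walk contains both: [w] ranks above
     [a], and only ear vertices ascend to [w]. *)
  + move=> x y xt yt xy cxy; rewrite /ear_g; case: (eqVneq x w) => [xw|xw]; case: (eqVneq y w) => [yw|yw] //.
    * by rewrite xw yw eqxx in xy.
    * rewrite xw in cxy; have := up_rank F cxy; apply: contraTneq => <-.
      by rewrite -ltnNge ear_lt_oe.
    * by rewrite aw // to_w // -yw.
  (* The walk through [w] starts in the ear, so its start descends to [a], to which the other walk
     ascends. *)
  + move=> x y u v xt yt xy + ux vy; rewrite /ear_g.
    case: (eqVneq x w) => [xw|xw]; case: (eqVneq y w) => [yw|yw] gxy.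
    * by rewrite xw yw eqxx in xy.
    * by right; exists a; rewrite gxy vy -gxy ear_conn_a // to_w // -xw.
    * by left; exists a; rewrite -gxy ux gxy ear_conn_a // to_w // -yw.
    * by rewrite gxy eqxx in xy.
  + move=> u v x y uv ruv xs yt ux vy; rewrite /ear_g; case: (eqVneq y w) => [yw|_]; last first.
      exact: (cs_q_g F uv ruv xs yt ux vy).
    have ve : v \in ear by rewrite to_w // -yw.
    have low z : fconnect p1' z x -> r' z <= r' a -> q' x != a.
      move=> zx za; have rx := down_rank F zx; have [_ _] := cs_down F xs.
      by apply: contraTneq => ->; rewrite -leqNgt; rank_lia.
    (* An old [u] related to [v] in the ear ranks at most as high as [a], so [q x] ranks below
       [a]. *)
    case: (inST u) => [uS|ue].
      apply: low ux _; case: uv => z [uz vz].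
      have [zS uz'] := ear_p2_conn_old uS uz.
      have [ze|[_ az]] := ear_p1_conn_new ve vz; first by rewrite (oldF zS) in ze.
      exact: leq_trans (up_rank F uz) (down_rank F (ear_p1_conn aS az)).
    have [xe|[xS ax]] := ear_p1_conn_new ue ux; last by apply: low (ear_p1_conn aS ax) _.
    case: (ear_downP xe) => [[_ -> _]|[z [ze _ -> _]]]; last by rewrite aw.
    (* The color is [c], which may equal [a] only if the ear has a single vertex; then [u] and [v]
       coincide. *)
    case: sac => // s1; move: ruv; rewrite ear_lt_ee //.
    have lu : index u ear < size ear by rewrite index_mem.
    have lv : index v ear < size ear by rewrite index_mem.
    by move: lu lv; rewrite s1 !ltnS !leqn0 => /eqP-> /eqP->.
- by apply: contraTneq (ps_t P) => ->; apply: earS.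
Qed.

(* If the last ear leaves from the vertex right below [b], then one of the
   edges joining [b] to a lower vertex is redundant, as [b] also has a lower
   neighbor in the ear. *)
Lemma ear_redundant_edge : S' = setT -> c = a ->
  exists x y, e x y /\ biconnected (delete_edge e x y).
Proof.
move=> ST ca; have PT := ear_partial_scheme; rewrite ST in PT.
have F := partial_scheme_full PT; have [le elb _] := ear_last.
have [he eah _] := ear_first.
have neqS x y : x \in ear -> y \in S -> x != y.
  by move=> xe yS; apply: contraTneq xe => ->; rewrite oldF.
have inST x : x \in S \/ x \in ear.
  by have := in_setT x; rewrite -ST inE in_set => /orP.
have rneq x y : r' x < r' y -> x != y by apply: contraTneq => ->; rewrite ltnn.
have bs : b != s.
  by rewrite eq_sym; apply: rneq; apply: leq_ltn_trans (root_min F a) _; rewrite ear_lt_oo.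
(* Without the edge [db], the vertex [b] still has the last ear vertex as a lower neighbor, so only
   higher neighbors of old vertices remain to be found. *)
have H d : d \in S -> e d b -> r' d < r' b -> (s != d) || (t != b) ->
    (forall x, x \in S -> x != t -> exists2 y, delete_edge e d b x y & r' x < r' y) ->
    biconnected (delete_edge e d b).
  move=> dS edb rdb std upp.
  apply: (st_numbering_biconnected (s := s) (t := t) (r := r')).
  - exact: delete_edge_sym.
  - exact: cs_inj F.
  - by rewrite /delete_edge /= (cs_st F) set2_neq // (eq_sym s) bs.
  - move=> x xs; have [ex rp rq] := cs_down F xs; have rx := leq_ltn_trans rp rq.
    case: (inST x) => [xS|xe].
      have [xb|xb] := eqVneq x b.
        exists (last a ear); last by rewrite xb ear_lt_eo.
        rewrite xb /delete_edge /= e_sym elb set2_neq //.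
          by rewrite (eq_sym b) (rneq _ _ rdb).
        by rewrite (neqS _ _ le dS) orbT.
      exists (p1' x) => //; rewrite /delete_edge /= ex set2_neq ?xb //.
      have [xd|//] := eqVneq x d; apply/eqP => pb; move: rx; rewrite pb xd.
      by rewrite ltnNge ltnW.
    exists (p1' x) => //; rewrite /delete_edge /= ex.
    by rewrite set2_neq // (neqS x) // .
  - move=> x xt; case: (inST x) => [xS|xe]; first exact: upp.
    have [ex rx] := cs_up F xt; exists (p2' x) => //.
    by rewrite /delete_edge /= ex set2_neq // (neqS x) // .
have rab' : r' a < r' b by rewrite ear_lt_oo.
have upneq x d : x != t -> r' d < r' b -> (x != b) || (p2' x != d).
  move=> xt rdb; have [_ rx] := cs_up F xt.
  have [xb|//] := eqVneq x b; apply/eqP => px; move: rx; rewrite px xb.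
  by rewrite ltnNge ltnW.
(* If [a] ascends directly to [b], the edge [ab] can go, as the first ear vertex is another higher
   neighbor of [a]. Otherwise the descending edge at [b] is deleted. *)
have [p2a|p2a] := eqVneq (p2 a) b.
  have at_ : a != t by apply: contraTneq rab => at_; rewrite -p2a at_ (ps_p2t P) ltnn.
  have [_ eab _] := ps_up P aS at_; rewrite p2a in eab.
  exists a, b; split=> //; apply: H => //.
    have [sa|//] := eqVneq s a; have := ps_p2s P.
    by rewrite sa p2a eq_sym.
  move=> x xS xt; have [xa|xa] := eqVneq x a.
    exists (head a ear); rewrite xa ?ear_lt_oe //.
    by rewrite /delete_edge /= eah set2_neq ?(neqS _ _ he) ?orbT // (rneq _ _ rab').
  have [ex rx] := cs_up F xt; exists (p2' x) => //.
  by rewrite /delete_edge /= ex set2_neq ?xa // upneq.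
have [dS qS ebd rpq rqb] := ps_down P bS bs.
have rdb : r' (p1 b) < r' b by rewrite ear_lt_oo // (leq_ltn_trans rpq).
exists (p1 b), b; rewrite e_sym; split=> //; apply: H => //; first by rewrite e_sym.
  have [sd|//] := eqVneq s (p1 b); have := ps_p1t P.
  by apply: contraNneq => ->; rewrite -sd.
move=> x xS xt; have [ex rx] := cs_up F xt; exists (p2' x) => //.
rewrite /delete_edge /= ex set2_neq // ?upneq //.
have [xd|//] := eqVneq x (p1 b); rewrite ear_p2_old //; apply/eqP => px.
(* If [p1 b] ascended directly to [b], then [a] would lie in the block of [b], and [p2 a] would rank
   strictly between [c = a] and [b]. *)
have qd : q b = p1 b by apply: (ps_both P) => //; rewrite -xd.
have ad : a != p1 b by apply: contraNneq p2a => ->; rewrite -xd px.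
have rda : r (p1 b) < r a.
  rewrite ltn_neqAle; apply/andP; split.
    by apply: contra ad => /eqP/(ps_inj P dS aS)->.
  by rewrite -ca; apply: c_pred => //; apply: leq_ltn_trans rpq rqb.
have cab : fconnect p2 a b by apply: (ps_block P) => //; rewrite ?qd // ltnW.
have ab : a != b by apply: contraTneq rab => ->; rewrite ltnn.
have pab := fconnect_next cab ab.
have at_ : a != t by apply: rneq; apply: leq_trans rab' (root_max F b).
have [p2aS _ rap] := ps_up P aS at_.
have [_ rpb] := partial_up_rank P p2aS pab.
have rpb' : r (p2 a) < r b.
  by rewrite ltn_neqAle rpb andbT; apply: contra p2a => /eqP/(ps_inj P p2aS bS)->.
by have := c_pred p2aS rpb'; rewrite ca leqNgt rap.
Qed.

End Ear.

(** * Existence of ears and the initial path *)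

Lemma avoiding_exit (T : finType) (e : rel T) (S : {set T}) v z y :
    connect (avoiding e v) z y -> z \notin S -> y \in S ->
  exists x b, [/\ x \notin S, b \in S, b != v, connect (outside e S) z x & e x b].
Proof.
case/connectP => p pth ->; elim: p z pth => [|u p IHp] z /=.
  by move=> _ zS; rewrite (negPf zS).
case/andP => /and3P[zv uv ezu] pth zS lS; have [uS|uS] := boolP (u \in S).
  by exists z, u; rewrite connect0.
have [x [b [xS bS bv ux exb]]] := IHp u pth uS lS.
exists x, b; split=> //; apply: connect_trans ux; apply: connect1.
exact/and3P.
Qed.

Lemma partial_scheme_ear (T : finType) (e : rel T) s t S r p1 p2 q :
    symmetric e -> biconnected e -> partial_scheme e s t S r p1 p2 q -> S != setT ->
  exists ear a b c, insertable_ear e S r ear a b c.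
Proof.
move=> e_sym bi P; rewrite -subTset => /subsetPn[z _ zS]; have [sS tS] := (ps_s P, ps_t P).
have st : s != t by apply: contraTneq (ps_p2s P) => ->; rewrite (ps_p2t P) eqxx.
(* The attachments of the component of [z]. By biconnectivity no single one separates [z] from the
   rest of [S], so there are two: [b] is a highest one and [a] another. *)
pose A := [pred b | (b \in S) && [exists x, [&& x \notin S, connect (outside e S) z x & e x b]]].
have exA v : v \in S -> exists2 b, A b & b != v.
  move=> vS; have zv : z != v by apply: contraNneq zS => ->.
  have [y yS yv] : exists2 y, y \in S & y != v.
    by have [<-|sv] := eqVneq s v; [exists t; rewrite // eq_sym | exists s].
  have [x [b [xS bS bv zx exb]]] := avoiding_exit (bi v z y zv yv) zS yS.
  by exists b => //=; rewrite bS; apply/existsP; exists x; rewrite xS zx.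
have [b0 Ab0 _] := exA s sS.
have [b Ab bmax] := arg_maxnP r Ab0.
have /andP[bS /existsP[y /and3P[yS zy eyb]]] := Ab.
have [a Aa ab] := exA b bS.
have /andP[aS /existsP[x /and3P[xS zx exa]]] := Aa.
have rab : r a < r b.
  have le_ab : r a <= r b := bmax a Aa.
  by rewrite ltn_neqAle le_ab andbT; apply: contra ab => /eqP/(ps_inj P aS bS)->.
have csym : connect_sym (outside e S) := sym_connect_sym (outside_sym S e_sym).
have xy : connect (outside e S) x y by apply: connect_trans zy; rewrite csym.
have [p pth [up lp]] : exists2 p, path (outside e S) x p & uniq (x :: p) /\ y = last x p.
  by case/connectP: xy => p /shortenP[p' ? ? _ ?]; exists p'.
pose B := [pred c | (c \in S) && (r c < r b)].
have Ba : B a by rewrite /= aS.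
have [c /andP[cS rcb] cmax] := arg_maxnP r Ba.
exists (x :: p), a, b, c; split=> //.
- move=> u; rewrite inE => /predU1P[-> //|].
  elim: p x pth {up lp xS zx exa xy} => // u' p IHp x /= /andP[/and3P[_ u'S _] pth].
  by rewrite inE => /predU1P[-> //|]; apply: IHp pth.
- rewrite /= e_sym exa rcons_path -lp eyb andbT; apply: sub_path pth.
  by move=> u v /and3P[].
- move=> y' v y'S vS xy' ey'v; apply: bmax; rewrite /= vS; apply/existsP; exists y'.
  by rewrite y'S ey'v andbT; apply: connect_trans zx xy'.
- by move=> y' y'S ry'; apply: cmax; rewrite /= y'S.
Qed.

(** At the ends, [0.-1 = 0] and the default of [nth] make [s] and [t] fixed points. Every block is a
    single vertex, and [q] is injective off [s], so [ps_cap] is vacuous. *)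
Lemma path_partial_scheme (T : finType) (e : rel T) (s t : T) (l : seq T) :
    symmetric e -> e s t -> l != [::] -> uniq (s :: rcons l t) -> path e s (rcons l t) ->
    let L := s :: rcons l t in
  partial_scheme e s t [set x in L] (index^~ L)
    (fun x => nth s L (index x L).-1) (fun x => nth t L (index x L).+1)
    (fun x => nth s L (index x L).-1).
Proof.
move=> e_sym est l0 uL pth L.
have lL : nth t L (size l).+1 = t by rewrite /= nth_rcons ltnn eqxx.
have sL : size L = (size l).+2 by rewrite /= size_rcons.
have tL : t \in L by rewrite /L inE mem_rcons mem_head orbT.
have iL x : x \in L -> index x L < (size l).+2 by rewrite -index_mem sL.
have it : index t L = (size l).+1 by rewrite -{1}lL index_uniq ?sL.
have is0 : index s L = 0 by rewrite /L /= eqxx.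
have ind x y : x \in L -> y \in L -> index x L = index y L -> x = y.
  by move=> xL yL E; rewrite -(nth_index s xL) E nth_index.
have pos x : x \in L -> x != s -> 0 < index x L.
  by rewrite /L /= eq_sym; case: eqP.
have ip x : x \in L -> index (nth s L (index x L).-1) L = (index x L).-1.
  by move=> xL; rewrite index_uniq // sL; have := iL x xL; lia.
have lst x : x \in L -> x != t -> (index x L).+1 < (size l).+2.
  move=> xL xt; rewrite ltn_neqAle iL // andbT -it eqSS; apply: contra xt => /eqP E.
  by apply/eqP/ind.
have ipp x : x \in L -> x != t -> index (nth t L (index x L).+1) L = (index x L).+1.
  by move=> xL xt; rewrite index_uniq // sL lst.
have st : s != t by apply/eqP => E; move: it; rewrite -E is0.
have sl : 0 < size l by rewrite lt0n size_eq0.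
have sSL : s \in L by rewrite mem_head.
have edge i : i < (size l).+1 -> e (nth s L i) (nth s L i.+1).
  by move=> lti; move/(pathP s)/(_ i): pth; rewrite size_rcons => /(_ lti).
split; rewrite ?in_set //.
- by move=> x y; rewrite !in_set => xL yL; apply: ind.
- by rewrite is0.
- by rewrite nth_default // it sL.
- apply/eqP => E; have := ipp s sSL st; rewrite E is0 it; rank_lia.
- apply/eqP => E; have := ip t tL; rewrite E is0 it /=; rank_lia.
- move=> x; rewrite in_set => xL xs; have px := pos x xL xs; have lx := iL x xL.
  have pL : nth s L (index x L).-1 \in L by rewrite mem_nth // sL; lia.
  rewrite !in_set pL ip // leqnn; split=> //; last by rank_lia.
  rewrite e_sym -{2}(nth_index s xL) -{2}(prednK px); apply: edge; rank_lia.
- move=> x; rewrite in_set => xL xt; have lx := lst x xL xt.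
  rewrite in_set mem_nth ?sL // ipp //; split=> //.
  rewrite -{1}(nth_index s xL) (set_nth_default s) ?sL //; exact: edge.
- move=> x y; rewrite !in_set => xL yL xs; rewrite ip // => i1 i2.
  have px := pos x xL xs; suff -> : x = y by apply: connect0.
  apply: ind => //; rank_lia.
- move=> x x' u v; rewrite !in_set => xL xL' _ _ xs xs' E lt.
  have := pos x xL xs; have := pos x' xL' xs'.
  have : (index x L).-1 = (index x' L).-1 by have := congr1 (index^~ L) E; rewrite !ip.
  by move: lt; set i := index x L; set j := index x' L; rank_lia.
Qed.


(* The color [w] is the one that is saved. *)
Definition saving_scheme (T : finType) (e : rel T) : Prop :=
  exists s t r p1 p2 q g w,
    [/\ color_scheme e s t r p1 p2 q g, t != w,
        forall x, x != s -> q x != w & forall x, g x != w].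

(** * Saving a color or finding a Hamiltonian cycle *)

Lemma saving_scheme_sub (T : finType) (e e' : rel T) :
  subrel e e' -> saving_scheme e -> saving_scheme e'.
Proof.
move=> ee' [s [t [r [p1 [p2 [q [g [w [F tw qw gw]]]]]]]]].
exists s, t, r, p1, p2, q, g, w; split=> //; split; try by case: F.
- exact: ee' (cs_st F).
- by move=> x /(cs_down F)[/ee'].
- by move=> x /(cs_up F)[/ee'].
Qed.

(** Ears are inserted until one exhausts the vertices; this last ear saves a color or, if [c = a],
    yields a redundant edge. *)
Lemma partial_scheme_dichotomy (T : finType) (e : rel T) s t S r p1 p2 q :
    symmetric e -> biconnected e -> partial_scheme e s t S r p1 p2 q -> S != setT ->
  saving_scheme e \/ exists x y, e x y /\ biconnected (delete_edge e x y).
Proof.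
move=> e_sym bi; have [n] := ubnP #|~: S|; elim: n S r p1 p2 q => // n IHn S r p1 p2 q ltn P ST.
have [ear [a [b [c E]]]] := partial_scheme_ear e_sym bi P ST.
have P' := ear_partial_scheme e_sym P E.
have [ST'|ST'] := eqVneq (S :|: [set x in ear]) setT.
  have [ca|ca] := eqVneq c a; last first.
    have [F tw qw gw] := ear_color_scheme e_sym P E ST' (or_intror ca).
    by left; do 8 eexists; split; [exact: F | exact: tw | exact: qw | exact: gw].
  by right; apply: (ear_redundant_edge e_sym P E ST' ca).
rewrite ltnS in ltn; apply: IHn P' ST'; apply: leq_trans ltn; apply: proper_card; apply/properP.
have [x xe] : exists x, x \in ear.
  by case: (ear) (ie_neq0 E) => // x l _; exists x; rewrite mem_head.
split; first by rewrite setCS subsetUl.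
by exists x; rewrite !inE ?(ie_outside E) // xe orbT.
Qed.

Lemma hamiltonian_partial_scheme (T : finType) (e : rel T) (s t : T) (l : seq T) :
    symmetric e -> l != [::] -> uniq (s :: rcons l t) -> cycle e (s :: rcons l t) ->
    (forall x, x \in s :: rcons l t) ->
  exists r p1 p2 q, partial_scheme e s t setT r p1 p2 q.
Proof.
move=> e_sym l0 uL; rewrite /cycle rcons_path last_rcons e_sym => /andP[pth est] allL.
have <- : [set x in s :: rcons l t] = setT by apply/setP => x; rewrite in_set allL inE.
do 4 eexists; exact: path_partial_scheme e_sym est l0 uL pth.
Qed.

(** One arc between [s] and [t] is the initial path and the other the last ear. The vertex right
    below [t] is interior to the first arc, hence is not [s]. *)
Lemma chord_saving_scheme (T : finType) (e : rel T) (p : seq T) (s t : T) :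
    symmetric e -> uniq p -> cycle e p -> (forall x, x \in p) ->
    e s t -> s != t -> next p s != t -> next p t != s ->
  saving_scheme e.
Proof.
move=> e_sym up cp allp est st; have [i p' rp] := rot_to (allp s).
rewrite -(next_rot i up s) -(next_rot i up t) rp.
have {up} : uniq (s :: p') by rewrite -rp rot_uniq.
have {cp} : cycle e (s :: p') by rewrite -rp rot_cycle.
have {}allp x : x \in s :: p' by rewrite -rp mem_rot.
have : t \in p' by have := allp t; rewrite inE eq_sym (negPf st).
move=> tp; case/splitPr: tp rp allp => l1 l2 _ allp cL uL nst nts {i}.
(* Since [st] is a chord, both arcs have interior vertices. *)
have l1n : l1 != [::] by apply: contraNneq nst => ->; rewrite /= eqxx.
have l2n : l2 != [::].
  apply: contraNneq nts => l20; move: uL; rewrite l20 next_nth inE mem_cat mem_head !orbT.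
  rewrite /= mem_cat negb_or cat_uniq => /and3P[/andP[_ _] _ /andP[/norP[tl1 _] _]].
  by rewrite (negPf st) index_cat (negPf tl1) /= eqxx addn0 nth_default // size_cat addn1.
have {}cL : path e s (rcons l1 t) && path e t (rcons l2 s).
  by move: cL; rewrite /= rcons_cat rcons_cons -cat_rcons cat_path last_rcons.
case/andP: cL => pth1 pth2.
have {}uL : uniq ((s :: rcons l1 t) ++ l2) by rewrite cat_cons cat_rcons.
have {}allp x : x \in (s :: rcons l1 t) ++ l2 by rewrite cat_cons cat_rcons.
have /and3P[uL1 /hasPn disj uL2] := etrans (esym (cat_uniq _ _)) uL.
have P := path_partial_scheme e_sym est l1n uL1 pth1.
have it : index t (s :: rcons l1 t) = (size l1).+1.
  by rewrite /= (negPf st) -cats1 index_cat; move: uL1; rewrite /= rcons_uniq => /and3P[_ /negPf-> _];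
     rewrite /= eqxx addn0.
have sS : s \in s :: rcons l1 t by rewrite mem_head.
have tS : t \in s :: rcons l1 t by rewrite inE mem_rcons mem_head orbT.
have lt y : y \in s :: rcons l1 t -> index y (s :: rcons l1 t) <= (size l1).+1.
  by rewrite -index_mem /= size_rcons ltnS.
have cl : last s l1 \in l1 by case: (l1) l1n => // x l _; rewrite /= mem_last.
have cS : last s l1 \in s :: rcons l1 t by rewrite inE mem_rcons inE cl !orbT.
have cs : last s l1 != s.
  by apply: contraTneq cl => ->; move: uL1; rewrite /= mem_rcons inE negb_or => /andP[/andP[]].
have ct : last s l1 != t.
  by apply: contraTneq cl => ->; move: uL1; rewrite /= rcons_uniq => /and3P[].
have ic : index (last s l1) (s :: rcons l1 t) = size l1.
  have -> : last s l1 = nth s (s :: rcons l1 t) (size l1).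
    by rewrite -rcons_cons nth_rcons /= ltnSn nth_last.
  by rewrite index_uniq //= size_rcons.
(* The list [l2] runs from [t] back to [s], hence the reversal. *)
have E : insertable_ear e [set x in s :: rcons l1 t] (index^~ (s :: rcons l1 t))
    (rev l2) s t (last s l1).
  split; rewrite ?in_set ?rev_uniq ?it ?ic //=.
  - by rewrite -size_eq0 size_rev size_eq0.
  - by move=> x; rewrite mem_rev in_set => /disj.
  - have := rev_path e t (rcons l2 s).
    rewrite last_rcons belast_rcons rev_cons => ->.
    by apply: sub_path pth2 => x y; rewrite /= e_sym.
  - by rewrite eqxx.
  - by move=> y v _; rewrite in_set => vS _ _; apply: lt vS.
have ST : [set x in s :: rcons l1 t] :|: [set x in rev l2] = setT.
  by apply/setP => x; rewrite in_setU !in_set mem_rev -mem_cat allp.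
have [F tw qw gw] := ear_color_scheme e_sym P E ST (or_intror cs).
by do 8 eexists; split; [exact: F | exact: tw | exact: qw | exact: gw].
Qed.

(** Some vertex [x] has two distinct neighbors [s] and [z], and a path from [z] to [s] avoiding [x]
    closes to a cycle through [x]. *)
Lemma biconnected_cycle_path (T : finType) (e : rel T) :
    symmetric e -> irreflexive e -> 2 < #|T| -> biconnected e ->
  exists s t l, [/\ e s t, l != [::], uniq (s :: rcons l t) & path e s (rcons l t)].
Proof.
move=> e_sym e_irr T3 bi.
have nbr v x y : x != v -> y != v -> x != y -> exists2 z, z != v & e x z.
  move=> xv yv xy; case/connectP: (bi v x y xv yv) => -[|z p] /=.
    by move=> _ yx; rewrite yx eqxx in xy.
  by case/andP => /and3P[_ zv exz] _ _; exists z.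
have /card_gt2P[v [x [y [_ [vx xy yv]]]]] : 2 < #|[set: T]| by rewrite cardsT.
have [s sv exs] : exists2 z, z != v & e x z by apply: (nbr v x y); rewrite // eq_sym.
have xs : x != s by apply: contraTneq exs => ->; rewrite e_irr.
have [z zs exz] : exists2 z, z != s & e x z.
  by apply: (nbr s x v); rewrite // eq_sym.
have zx : z != x by apply: contraTneq exz => ->; rewrite e_irr.
have sx : s != x by rewrite eq_sym.
case/connectP: (bi x z s zx sx) => p0 /shortenP[p pth up _ {p0} ls].
have {}ls : last z p = s by [].
exists x, s, (belast z p).
have E : rcons (belast z p) s = z :: p by rewrite -ls -lastI.
rewrite E; split=> //.
- case: p {pth up E} ls => //= zs'; by rewrite zs' eqxx in zs.
- rewrite cons_uniq up andbT.
  elim: p z pth {up ls E zs exz} zx => /= [|u p IHp] z; first by rewrite inE eq_sym.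
  by case/andP => /and3P[_ ux _] pth zx; rewrite inE negb_or eq_sym zx IHp.
- by rewrite /= exz; apply: sub_path pth => a b /and3P[].
Qed.

(** Induction on the number of adjacent ordered pairs: a scheme or a spanning cycle of the graph
    without an edge also serves the graph itself. *)
Lemma biconnected_dichotomy (T : finType) (e : rel T) :
    symmetric e -> irreflexive e -> 2 < #|T| -> biconnected e ->
  saving_scheme e \/ exists p, [/\ uniq p, cycle e p & forall x, x \in p].
Proof.
move=> e_sym e_irr T3; have [n] := ubnP #|[set u | e u.1 u.2]|.
elim: n e e_sym e_irr => // n IHn e e_sym e_irr ltn bi.
have [s [t [l [est l0 uL pth]]]] := biconnected_cycle_path e_sym e_irr T3 bi.
have P := path_partial_scheme e_sym est l0 uL pth.
have [LT|LT] := eqVneq [set x in s :: rcons l t] setT.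
  right; exists (s :: rcons l t); split=> //.
    by rewrite /cycle rcons_path pth last_rcons e_sym.
  by move=> x; have := in_setT x; rewrite -LT in_set.
have [|[x [y [exy bi']]]] := partial_scheme_dichotomy e_sym bi P LT; first by left.
have sub : subrel (delete_edge e x y) e by move=> u v /andP[].
have [||||S|[p [up cp allp]]] := IHn (delete_edge e x y).
- exact: delete_edge_sym.
- by move=> u; rewrite /delete_edge /= e_irr.
- rewrite ltnS in ltn; apply: leq_trans ltn; apply: proper_card; apply/properP.
  split; first by apply/subsetP => u; rewrite !inE => /sub.
  by exists (x, y); rewrite !inE //= /delete_edge /= eqxx andbF.
- exact: bi'.
- by left; apply: saving_scheme_sub S.
- by right; exists p; split=> //; apply: sub_cycle cp.
Qed.

(** * The upper bound for 2-connected graphs *)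

Lemma two_connected_biconnected (G : sgraph) :
  two_connected G -> 2 < #|G| /\ biconnected (@adj G).
Proof.
case=> G2 conn; split=> // v x y xv yv.
have [|_ /(_ x y)] := conn [set v]; first by rewrite cards1.
rewrite !in_setC !in_set1 => /(_ xv yv); apply: etrans; apply: eq_connect => a b.
by rewrite /= !in_setC !in_set1.
Qed.

Lemma val_ordS n (i : 'I_n) : (ordS i : nat) = if i.+1 == n then 0 else i.+1.
Proof.
rewrite /=; case: eqP => [->|/eqP ni]; first by rewrite modnn.
by rewrite modn_small // ltn_neqAle ni ltn_ord.
Qed.

Lemma hamiltonian_is_cycle (G : sgraph) (p : seq G) :
    2 < #|G| -> uniq p -> cycle (@adj G) p -> (forall x, x \in p) ->
    (forall x y, adj x y -> next p x = y \/ next p y = x) ->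
  is_cycle G #|G|.
Proof.
move=> G2 up cp allp nochord; split=> //.
have sp : size p = #|G| by rewrite -(card_uniqP up); apply: eq_card => x; rewrite allp.
have [x0 _] : exists x0 : G, x0 \in p by case: (p) sp G2 => [/= <-|x l _ _] //; exists x; rewrite mem_head.
pose f (i : 'I_#|G|) := nth x0 p i.
have f_inj : injective f.
  by move=> i j /eqP; rewrite nth_uniq ?sp // => /eqP/val_inj.
have nextf i : next p (f i) = f (ordS i).
  rewrite next_nth allp {2}/f index_uniq ?sp // /f val_ordS; have := ltn_ord i.
  case: (p) sp => [/= G0 _|y l sl lti]; first by rewrite -G0 in G2.
  case: eqP => [E|/eqP iG].
    by rewrite nth_default // -ltnS E -sl.
  have li : i < size l by rewrite -ltnS -[(size l).+1]/(size (y :: l)) sl ltn_neqAle iG.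
  exact: set_nth_default.
exists f => [|i j]; first by apply: inj_card_bij; rewrite ?card_ord.
apply/idP/orP => [/nochord|].
  by rewrite !nextf => -[/f_inj->|/f_inj->]; [left|right].
by case=> /eqP->; rewrite -nextf; [|rewrite adj_sym]; apply: next_cycle.
Qed.

Lemma rainbow_coloring_dichotomy (G : sgraph) : two_connected G ->
  rainbow_2connectable G #|G|.-1 \/ is_cycle G #|G| /\ rainbow_2connectable G #|G|.
Proof.
case/two_connected_biconnected => G2 bi.
have saving : saving_scheme (@adj G) -> rainbow_2connectable G #|G|.-1.
  case=> s [t [r [p1 [p2 [q [g [w [F tw qw gw]]]]]]]]; rewrite -(cardsC1 w).
  by apply: (scheme_connectable F) => [|x xs|x _]; rewrite !inE ?qw.
have [/saving|[p [up cp allp]]] :=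
  biconnected_dichotomy (@adj_sym G) (@adj_irrefl G) G2 bi; first by left.
have [[s [t [st nst nts]]]|nochord] :=
    EM (exists s t : G, [/\ adj s t, next p s != t & next p t != s]).
  left; apply: saving; apply: (chord_saving_scheme (@adj_sym G) up cp allp st _ nst nts).
  by apply: contraTneq st => ->; rewrite adj_irrefl.
right; split.
  apply: hamiltonian_is_cycle up cp allp _ => // x y xy; apply: contrapT => nxy.
  by apply: nochord; exists x, y; split=> //; apply/eqP => E; apply: nxy; auto.
have sp : size p = #|G| by rewrite -(card_uniqP up); apply: eq_card => x; rewrite allp.
case: p => [|s p] in up cp allp sp {nochord} *; first by rewrite -sp in G2.
case/lastP: p => [|l t] in up cp allp sp *; first by rewrite -sp in G2.
have l0 : l != [::] by apply: contraTneq G2 => l0; rewrite -sp l0.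
(* The chordless cycle is a path closed by the edge [st]; its scheme uses at most one color per
   vertex. *)
have [r [p1 [p2 [q P]]]] := hamiltonian_partial_scheme (@adj_sym G) l0 up cp allp.
by rewrite -cardsT; apply: (scheme_connectable (partial_scheme_full P)) => *; rewrite inE.
Qed.

(** * The lower bound for cycles *)

Lemma uniq_map_inj (T1 T2 : eqType) (f : T1 -> T2) (l : seq T1) :
  uniq [seq f x | x <- l] -> {in l &, injective f}.
Proof.
elim: l => //= z l IHl /andP[zl ul] x y; rewrite !inE.
case/predU1P => [->|xl] /predU1P[->|yl] // E; last exact: IHl.
- by rewrite E map_f in zl.
- by rewrite -E map_f in zl.
Qed.

Lemma mem_path_edges (G : sgraph) (u x : G) p (F : {set G}) :
  F \in path_edges u p -> x \in F -> x \in u :: p.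
Proof.
elim: p u => //= y p IHp u; rewrite inE => /predU1P[->|Fp xF].
  by rewrite !inE => /orP[->|->]; rewrite ?orbT.
by rewrite inE (IHp y Fp xF) orbT.
Qed.

(** The edge comes first, as [u] does not recur, and the path stops there, as [v] does not recur. *)
Lemma path_through_direct_edge (G : sgraph) (u v : G) p :
  u != v -> is_path u v p -> [set u; v] \in path_edges u p -> p = [:: v].
Proof.
move=> uv /and3P[_ lp up]; case: p lp up => //= y p lp /andP[uyp yp].
rewrite inE => /predU1P[E|Ep].
  have yv : v = y.
    have := set22 u v; rewrite E !inE => /predU1P[vu|/eqP //].
    by rewrite vu eqxx in uv.
  rewrite yv in lp *; case: p lp yp {uyp E} => //= z p /eqP lz /andP[].
  by rewrite -lz mem_last.
by rewrite (mem_path_edges Ep (set21 _ _)) in uyp.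
Qed.

Lemma path_crosses_cut (G : sgraph) (A : pred G) (u : G) p :
    path (@adj G) u p -> A u != A (last u p) ->
  exists x y, [/\ adj x y, A x != A y & [set x; y] \in path_edges u p].
Proof.
elim: p u => [|y p IHp] u /=; first by rewrite eqxx.
case/andP => uy pth Aup; have [Auy|Auy] := eqVneq (A u) (A y).
  have [|x [z [xz Axz zp]]] := IHp y pth; first by rewrite -Auy.
  by exists x, z; rewrite inE zp orbT.
by exists u, y; rewrite inE eqxx.
Qed.

(* Deleting two edges disconnects a cycle, so a path joining the ends of an
   edge and avoiding this edge contains all the other edges. *)
Lemma cycle_path_edges (G : sgraph) n (f : 'I_n -> G) (l i : 'I_n) p :
    bijective f ->
    (forall i j : 'I_n, adj (f i) (f j) = (j == ordS i) || (i == ordS j)) ->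
    i != l -> is_path (f l) (f (ordS l)) p ->
    [set f l; f (ordS l)] \notin path_edges (f l) p ->
  [set f i; f (ordS i)] \in path_edges (f l) p.
Proof.
case=> g fK gK adjf il /and3P[pth /eqP lp _] lnp.
(* One of the two arcs that remain when the edges at [l] and [i] are deleted; by [cut], only these
   edges leave it. *)
pose A x := minn l i < g x <= maxn l i.
have cut a : (A (f a) != A (f (ordS a))) = (a == l) || (a == i).
  rewrite /A !fK val_ordS -!val_eqE /=.
  have := ltn_ord a; have := ltn_ord l; have := ltn_ord i; move: il; rewrite -val_eqE /=.
  move: (nat_of_ord a) (nat_of_ord l) (nat_of_ord i) => x y z; clear.
  by case: (x.+1 =P n); lia.
have [|x [y [xy Axy xyp]]] := path_crosses_cut (A := A) pth.
  by rewrite lp cut eqxx.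
have key a : A (f a) != A (f (ordS a)) -> [set f a; f (ordS a)] \in path_edges (f l) p ->
    [set f i; f (ordS i)] \in path_edges (f l) p.
  by rewrite cut => /pred2P[->|-> //]; rewrite (negPf lnp).
rewrite -(gK x) -(gK y) adjf in xy.
case/orP: xy => /eqP E.
  by apply: (key (g x)); rewrite -E !gK.
by apply: (key (g y)); rewrite -E !gK 1?eq_sym 1?setUC.
Qed.

Lemma cycle_lower_bound (G : sgraph) n k :
  is_cycle G n -> rainbow_2connectable G k -> n <= k.
Proof.
case=> n2 [f f_bij adjf] [c ck rc].
have fS i : adj (f i) (f (ordS i)) by rewrite adjf eqxx.
pose F i := [set f i; f (ordS i)].
suff h_inj : injective (fun i => Ordinal (ck _ _ (fS i))).
  by have := leq_card _ h_inj; rewrite !card_ord.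
move=> i j [cij]; apply/eqP/contraT => ij.
(* A third edge, which exists as [n] exceeds 2. Any other path between its ends contains both edges
   of equal color. *)
have [l li lj] : exists2 l : 'I_n, i != l & j != l.
  have : ~~ ([set: 'I_n] \subset [set i; j]).
    apply/negP => /subset_leq_card; rewrite cardsT card_ord cards2 ij.
    by rewrite leqNgt n2.
  by case/subsetPn => l _; rewrite !inE negb_or => /andP[]; exists l; rewrite eq_sym.
have uv : f l != f (ordS l) by apply: contraTneq (fS l) => ->; rewrite adj_irrefl.
have bad p : is_path (f l) (f (ordS l)) p -> rainbow c (f l) p -> p = [:: f (ordS l)].
  move=> pth rp; apply: (path_through_direct_edge uv pth).
  apply/contraT => lp.
  have ip := cycle_path_edges f_bij adjf li pth lp.
  have jp := cycle_path_edges f_bij adjf lj pth lp.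
  have [[fij _]|[fij fji]] := set2_eq (uniq_map_inj rp ip jp cij).
    by rewrite (bij_inj f_bij fij) eqxx in ij.
  (* The edges at [i] and [j] coincide with their ends swapped, which is impossible for [n > 2]. *)
  have := congr1 (@nat_of_ord n) (bij_inj f_bij fij).
  have := congr1 (@nat_of_ord n) (bij_inj f_bij fji).
  move: ij; rewrite !val_ordS -val_eqE /=.
  have := ltn_ord i; have := ltn_ord j; move: n2.
  move: (nat_of_ord i) (nat_of_ord j) => a b; clear.
  by case: (a.+1 =P n); case: (b.+1 =P n); lia.
have [p [q [/andP[pp pq] /andP[rp rq] npq _]]] := rc _ _ uv.
by rewrite (bad p pp rp) (bad q pq rq) eqxx in npq.
Qed.

(** * The minimum number of colors and the optimal constant *)

Lemma rc2_exists (G : sgraph) k : rainbow_2connectable G k ->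
  exists2 r, is_rc2 G r & r <= k.
Proof.
move=> Gk; have exk : exists k, `[< rainbow_2connectable G k >].
  by exists k; apply/asboolP.
case: (ex_minnP exk) => r /asboolP Gr rmin; exists r; last exact/rmin/asboolP.
by split=> // j Gj; apply/rmin/asboolP.
Qed.

Lemma rc2_order (G : sgraph) : two_connected G ->
  exists2 r, is_rc2 G r & r <= #|G| /\ (r = #|G| <-> is_cycle G #|G|).
Proof.
move=> G2c; have G2 : 2 < #|G| by case: G2c.
have cyc r : is_rc2 G r -> r <= #|G| -> is_cycle G #|G| -> r = #|G|.
  move=> [Gr _] rG Gc; apply/eqP; rewrite eqn_leq rG.
  exact: cycle_lower_bound Gc Gr.
have [Gn|[Gc Gn]] := rainbow_coloring_dichotomy G2c; have [r Gr rn] := rc2_exists Gn.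
  have rG := leq_trans rn (leq_pred _); exists r => //; split=> //.
  by split=> [E|/cyc]; [move: rn; rewrite E; lia | exact].
by exists r => //; split=> //; split=> // _; apply: cyc.
Qed.

(** A cycle attains the bound, so this single graph rules out every constant below [1]. *)
Definition triangle : sgraph :=
  @SGraph 'I_3 (fun i j => i != j) (fun i j => congr1 negb (eq_sym i j))
    (fun i => congr1 negb (eqxx i)).

Lemma triangle_is_cycle : is_cycle triangle 3.
Proof.
split=> //; exists id; first by exists id.
by do 2 (case=> [[|[|[|]]] ?] //).
Qed.

Lemma triangle_two_connected : two_connected triangle.
Proof.
split=> [|X X2]; first by rewrite card_ord.
split=> [|x y xX yX].
  rewrite -card_gt0; have := cardsC X; rewrite card_ord; lia.
have [->|xy] := eqVneq x y; first exact: connect0.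
by apply: connect1; rewrite /= xX yX.
Qed.

Theorem theorem1p4 :
  (forall (G : sgraph) (n : nat), two_connected G -> #|G| = n ->
     exists2 r : nat, is_rc2 G r & r <= n /\ (r = n <-> is_cycle G n)) /\
  (forall R : realType, is_min_rc2_constant (1%R : R)).
Proof.
split=> [G n G2 <-|R]; first exact: rc2_order.
split=> [|G /rc2_order[r Gr [rG _]]|b b0 /(_ _ triangle_two_connected)[r [Gr _]]].
- exact: Num.Theory.ltr01.
- by exists r => //; rewrite GRing.mul1r Num.Theory.ler_nat.
- rewrite card_ord => rb; have r3 := cycle_lower_bound triangle_is_cycle Gr.
  have : (3%:R <= b * 3%:R :> R)%R.
    by apply: Order.POrderTheory.le_trans rb; rewrite Num.Theory.ler_nat.
  by rewrite -[X in (X <= _)%R]GRing.mul1r Num.Theory.ler_pM2r // Num.Theory.ltr0n.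
Qed.
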